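(* Let $d \ge 4$ and let $P$ be a $2$-neighborly $d$-polytope with $f_0(P) \ge d+4$ vertices. Then $P$ has at least $d+7$ facets. Equivalently, $\operatorname{mn}(d,v) \ge d+7$ for all $v \ge d+4$, where $\operatorname{mn}(d,v)$ is the minimal number of facets of a $2$-neighborly $d$-polytope with $v$ vertices.
   Context: A $d$-polytope is a $d$-dimensional convex polytope; $f_0(P)$ is its number of vertices. $P$ is $2$-neighborly if every pair of vertices of $P$ forms an edge ($1$-face) of $P$. *)

(* Defs.v *)
From HB Require Import structures.
From mathcomp Require Import all_boot all_order all_algebra finmap.
From mathcomp Require Import boolp classical_sets cardinality reals convex.
Set Implicit Arguments.
Unset Strict Implicit.
Unset Printing Implicit Defensive.
Import Order.TTheory GRing.Theory Num.Theory.
Local Open Scope classical_set_scope.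
Local Open Scope ring_scope.

Section Polytopes.
Variables (R : realType) (n : nat).
Implicit Types (A P F : set 'rV[R]_n).

Definition convex_hull A : set 'rV[R]_n :=
  smallest (@convex_set R 'rV[R]_n) A.

Definition affine_set A : Prop :=
  forall x y (t : R), A x -> A y -> A (t *: x + (1 - t) *: y).

Definition affine_hull A : set 'rV[R]_n := smallest affine_set A.

(* The affine hull of A is a translate of a k-dimensional linear subspace;
   the empty set has no dimension in nat. *)
Definition has_dim A (k : nat) : Prop :=
  exists (p : 'rV[R]_n) (U : {vspace 'rV[R]_n}),
    affine_hull A = [set p + u | u in [set` U]] /\ \dim U = k.

Definition polytope P : Prop :=
  exists2 V : set 'rV[R]_n, finite_set V & P = convex_hull V.

Definition d_polytope (d : nat) P : Prop := polytope P /\ has_dim P d.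

Definition dotv (c x : 'rV[R]_n) : R := \sum_(i < n) c 0 i * x 0 i.

(* c = 0 is allowed, so that P itself and the empty set are faces of P. *)
Definition face P F : Prop :=
  exists (c : 'rV[R]_n) (b : R),
    (forall x, P x -> dotv c x <= b) /\ F = P `&` [set x | dotv c x = b].

Definition kface (k : nat) P F : Prop := face P F /\ has_dim F k.

(* fset_set sends an infinite set to the empty fset; a polytope has only
   finitely many faces, so this never happens for a polytope. *)
Definition f_num (k : nat) P : nat := #|` fset_set [set F | kface k P F] |.

Definition vertex P (x : 'rV[R]_n) : Prop := kface 0 P [set x].

Definition two_neighborly P : Prop :=
  forall x y, vertex P x -> vertex P y -> x <> y ->
    kface 1 P (convex_hull [set x; y]).

End Polytopes.

(* m = mn(d, v), as a relation: m is the least element of the set of facet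
   numbers of 2-neighborly d-polytopes (in any ambient R^n) with v vertices. *)
Definition is_mn (R : realType) (d v m : nat) : Prop :=
  (exists (n : nat) (P : set 'rV[R]_n),
     [/\ d_polytope d P, two_neighborly P, f_num 0 P = v & f_num d.-1 P = m])
  /\ (forall (n : nat) (P : set 'rV[R]_n),
        d_polytope d P -> two_neighborly P -> f_num 0 P = v ->
        (m <= f_num d.-1 P)%N).

(* Main.v *)
(* Replace a 2-neighborly d-polytope by its face lattice: a family of sets of
   vertices that is closed under intersection and graded by rk = dim + 1, in
   which every interval of length 2 has exactly two inner elements and every
   vertex and every pair of vertices is a face.  By induction on the rank r, a
   face with at least r + 2 vertices has at least r + 6 facets: in dimension d,
   d + 3 vertices already force d + 7 facets.

   Suppose that G is a counterexample.  A facet of G has fewer facets than G,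
   so by induction it has r - 1 or r vertices.  If all facets of G are
   simplices, then counting edges and ridges gives a contradiction.
   Otherwise some facet F has one vertex more than a simplex, and then it is
   an iterated pyramid over a direct sum of two simplices; the bound on the
   number of facets only allows the direct sum of two triangles.  An apex of F
   would be missed by at most two facets of G, which contradicts
   2-neighborliness, so r = 6 and every facet of G has 5 or 9 facets.  Since
   each ridge lies in two facets, the number of facets of G is even, hence 10:
   they are F and its 9 neighbors.  The vertices outside F cannot be
   distributed over these 9 facets. *)
From mathcomp Require Import all_boot all_order all_algebra finmap.
From mathcomp Require Import zify.
From mathcomp Require Import boolp classical_sets cardinality reals convex.
From mathcomp Require Import interval_inference.
Require Import Defs.
From mathcomp Require Import fintype finset.
Set Implicit Arguments.
Unset Strict Implicit.
Unset Printing Implicit Defensive.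

(** * Graded lattices of faces *)

Ltac card_lia :=
  repeat match goal with
  | H : is_true (_ <= _)%N |- _ => revert H
  | H : @eq ?T _ _ |- _ => unify T nat; revert H
  | H : ~ (@eq ?T _ _) |- _ => unify T nat; revert H
  end;
  clear; lia.

(** No largest element is demanded, so the same axioms serve every face [G] together with the faces
    below it; inductions vary [G] and keep [L] fixed. *)
Record graded_lattice (V : finType) (L : {set {set V}}) (rk : {set V} -> nat) :
    Prop := GradedLattice {
  graded_set0 : set0 \in L;
  graded_rk0 : rk set0 = 0;
  graded_setI : forall S G, S \in L -> G \in L -> S :&: G \in L;
  graded_rk : forall S G, S \in L -> G \in L -> S \proper G -> rk S < rk G;
  graded_between : forall S G, S \in L -> G \in L -> S \proper G ->
    (rk S).+1 < rk G -> exists2 H, H \in L & (S \proper H) && (H \proper G);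
  graded_diamond : forall S G, S \in L -> G \in L -> S \proper G ->
    rk G = (rk S).+2 -> #|[set H in L | (S \proper H) && (H \proper G)]| = 2
}.

(** The case [x = y] makes every element of [V] a vertex: its singleton is a face of rank 1. *)
Definition neighborly_lattice (V : finType) (L : {set {set V}})
    (rk : {set V} -> nat) : Prop :=
  forall x y, [set x; y] \in L /\ rk [set x; y] = (x != y).+1.

(* Locked so that [inE] does not unfold membership. *)
Definition facets (V : finType) (L : {set {set V}}) (rk : {set V} -> nat)
    (G : {set V}) : {set {set V}} :=
  locked [set H in L | (H \proper G) && ((rk H).+1 == rk G)].

Section GradedLattice.

Variables (V : finType) (L : {set {set V}}) (rk : {set V} -> nat).
Hypothesis grL : graded_lattice L rk.
Implicit Types (G H K R S : {set V}) (x y : V).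

Local Notation facets := (facets L rk).

Lemma facetP G H :
  reflect [/\ H \in L, H \proper G & (rk H).+1 = rk G] (H \in facets G).
Proof.
rewrite /facets -lock inE; apply: (iffP and3P) => [[? ? /eqP]|[-> -> ->]] //.
Qed.

Lemma rk_subset S G : S \in L -> G \in L -> S \subset G -> rk S <= rk G.
Proof.
move=> SL GL; rewrite subEproper => /orP[/eqP->//|/(graded_rk grL SL GL)].
exact: ltnW.
Qed.

Lemma eq_facet G H K : H \in facets G -> K \in facets G -> H \subset K -> H = K.
Proof.
move=> /facetP[HL _ rH] /facetP[KL _ rK]; rewrite subEproper.
by case/orP=> [/eqP//|/(graded_rk grL HL KL)]; card_lia.
Qed.

(** A proper face over [S] with the most vertices has corank one, for otherwise [graded_between]
    would provide a larger one. *)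
Lemma exists_facet S G : S \in L -> G \in L -> S \proper G ->
  exists2 H, H \in facets G & S \subset H.
Proof.
move=> SL GL SG.
pose P H := [&& H \in L, S \subset H & H \proper G].
have PS : P S by rewrite /P SL subxx.
case: (@arg_maxnP _ S P (fun H => #|H|) PS) => H /and3P[HL SH HG] Hmax.
exists H => //; apply/facetP; split=> //.
have rHG := graded_rk grL HL GL HG.
case: (ltngtP (rk H).+1 (rk G)) => // [rlt|]; last by card_lia.
have [K KL /andP[HK KG]] := graded_between grL HL GL HG rlt.
have /Hmax : P K by rewrite /P KL KG (subset_trans SH (proper_sub HK)).
by have := proper_card HK; card_lia.
Qed.

(** The diamond between [R] and [G] has exactly one inner face [K] besides [H]. If [K] and [H] met
    strictly above [R], the intersection would have the rank of [H], forcing [H] into [K] although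
    their ranks agree. *)
Lemma facet_of_facet G H R : G \in L -> H \in facets G -> R \in facets H ->
  exists2 K, K \in facets G & K :&: H = R.
Proof.
move=> GL /facetP[HL HG rH] /facetP[RL RH rR].
have RG := proper_trans RH HG.
have /(graded_diamond grL RL GL RG) : rk G = (rk R).+2 by card_lia.
set D := [set _ in _ | _] => cD.
have HD : H \in D by rewrite inE HL RH HG.
have : 0 < #|D :\ H| by have := cardsD1 H D; rewrite HD cD add1n => -[<-].
case/card_gt0P=> K; rewrite !inE => /and4P[KH KL RK KG].
have rRK := graded_rk grL RL KL RK; have rKG := graded_rk grL KL GL KG.
exists K; first by apply/facetP; split=> //; card_lia.
have KHL := graded_setI grL KL HL.
have RKH : R \subset K :&: H by rewrite subsetI !proper_sub.
apply/esym/eqP; rewrite eqEsubset RKH; apply/negPn/negP=> nKHR.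
have rKH : rk R < rk (K :&: H) by apply: (graded_rk grL) => //; rewrite properE RKH.
have [HK|nHK] := boolP (H \subset K).
  have : H \proper K by rewrite properEneq eq_sym KH.
  by move/(graded_rk grL HL KL); rewrite ltnNge -ltnS rH rKG.
have : K :&: H \proper H.
  by rewrite properE subsetIr subsetI subxx andbT.
by move/(graded_rk grL KHL HL); rewrite -rR ltnS leqNgt rKH.
Qed.

(** Induction on the rank: if a facet [H] over [S] contains [x], some facet [R] of [H] over [S]
    avoids [x], and the second facet through [R] meets [H] only in [R], so it avoids [x] too. *)
Lemma facet_avoiding S G x : S \in L -> G \in L -> S \subset G ->
  x \in G -> x \notin S -> exists2 H, H \in facets G & (S \subset H) && (x \notin H).
Proof.
move=> SL; have [n] := ubnP (rk G); elim: n G => // n IH G rG GL SG xG xS.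
have SpG : S \proper G by rewrite properE SG; apply: contra xS => /subsetP->.
have [H HF SH] := exists_facet SL GL SpG.
have [xH|xH] := boolP (x \in H); last by exists H; rewrite ?SH.
have /facetP[HL HG rH] := HF.
have [|R RF /andP[SR xR]] := IH H _ HL SH xH xS; first by card_lia.
have [K KF KH] := facet_of_facet GL HF RF; exists K => //.
apply/andP; split; first by apply: subset_trans SR _; rewrite -KH subsetIl.
by apply: contra xR => xK; rewrite -KH inE xK.
Qed.

Lemma facet_traces G H S : G \in L -> H \in facets G ->
  [set R in facets H | S \subset R] \subset
  [set K :&: H | K in [set K in facets G | S \subset K] :\ H].
Proof.
move=> GL HF; apply/subsetP=> R; rewrite inE => /andP[RF SR].
have [K KF KH] := facet_of_facet GL HF RF.
apply/imsetP; exists K => //; rewrite in_setD1 in_set KF andTb.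
apply/andP; split; last by apply: subset_trans SR _; rewrite -KH subsetIl.
apply/eqP=> KeH; move: RF; rewrite -KH KeH setIid => /facetP[_].
by rewrite properxx.
Qed.

Lemma card_ridge_facets G R : R \in L -> G \in L -> R \proper G ->
  rk G = (rk R).+2 -> #|[set K in facets G | R \subset K]| = 2.
Proof.
move=> RL GL RG rG; rewrite -(graded_diamond grL RL GL RG rG).
apply: eq_card => K; rewrite in_set [RHS]in_set.
apply/andP/and3P => [[/facetP[KL KG rK] RK]|[KL RK KG]].
  split=> //; rewrite properEneq RK andbT; apply: contra_eqN rK => /eqP<-.
  by rewrite rG; apply/eqP; card_lia.
have rRK := graded_rk grL RL KL RK; have rKG := graded_rk grL KL GL KG.
by split; [apply/facetP; split=> //; card_lia | apply: proper_sub].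
Qed.

(** Distinct facets of [H] over [S] are cut out by distinct facets of [G] other than [H]; counting
    [H] itself makes the inequality strict. *)
Lemma card_facets_containing G H S : G \in L -> H \in facets G -> S \subset H ->
  #|[set R in facets H | S \subset R]| < #|[set K in facets G | S \subset K]|.
Proof.
move=> GL HF SH; rewrite (cardsD1 H [set K in facets G | _]).
rewrite in_set HF SH add1n ltnS.
apply: leq_trans (subset_leq_card (facet_traces S GL HF)) _.
exact: leq_imset_card.
Qed.

(** [card_facets_containing] gains one at each step of a chain of facets from [G] down to [S]. For
    an edge [S] this gives the bound [rk G - 2] used in the counts below. *)
Lemma rk_codim_le S G : S \in L -> G \in L -> S \subset G ->
  rk G - rk S <= #|[set K in facets G | S \subset K]|.
Proof.
move=> SL; have [n] := ubnP (rk G); elim: n G => // n IH G rG GL SG.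
move: (SG); rewrite subEproper => /predU1P[->|SpG]; first by rewrite subnn.
have [H HF SH] := exists_facet SL GL SpG; have /facetP[HL _ rH] := HF.
have := card_facets_containing GL HF SH.
have /(_ _ HL SH) := IH H; have := graded_rk grL SL GL SpG.
card_lia.
Qed.

Lemma card_facets_lt G H : G \in L -> H \in facets G -> #|facets H| < #|facets G|.
Proof.
move=> GL HF; have := card_facets_containing GL HF (sub0set H).
by congr (_ < _); apply: eq_card => K; rewrite in_set sub0set andbT.
Qed.

Lemma rk_le_card G : G \in L -> rk G <= #|G|.
Proof.
have [n] := ubnP (rk G); elim: n G => // n IH G rG GL.
have [->|G0] := eqVneq G set0; first by rewrite (graded_rk0 grL).
have pG : set0 \proper G by rewrite proper0.
have [H /facetP[HL HG rH] _] := exists_facet (graded_set0 grL) GL pG.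
have := proper_card HG; have /(_ _ HL) := IH H; card_lia.
Qed.

(** The equation [#|G| = rk G] encodes that [G] is a simplex. A facet avoiding [x] has at least
    [rk G - 1] vertices by [rk_le_card], so it is all of [G :\ x]. *)
Lemma simplex_facet G x : G \in L -> #|G| = rk G -> x \in G -> G :\ x \in facets G.
Proof.
move=> GL cG xG.
have [] := facet_avoiding (graded_set0 grL) GL (sub0set G) xG; first by rewrite inE.
move=> H HF /andP[_ xH]; suff -> : G :\ x = H by [].
have /facetP[HL /proper_sub HG rH] := HF.
apply/esym/eqP; rewrite eqEcard subsetD1 HG xH /=.
by have := rk_le_card HL; have := cardsD1 x G; rewrite xG; card_lia.
Qed.

Lemma card_facets_simplex G : G \in L -> #|G| = rk G -> #|facets G| = rk G.
Proof.
move=> GL cG; rewrite -cG -(card_in_imset (f := fun x => G :\ x) (D := G)); last first.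
  move=> x y xG _ exy; have : x \notin G :\ y by rewrite -exy !inE eqxx.
  by rewrite !inE xG andbT negbK => /eqP.
apply: eq_card => H; apply/idP/imsetP => [HF|[x xG ->]]; last exact: simplex_facet.
have /facetP[HL /properP[HG [x xG xH]] rH] := HF.
exists x => //; apply: (eq_facet HF (simplex_facet GL cG xG)).
by rewrite subsetD1 HG.
Qed.

End GradedLattice.

(** * Polytopes with one vertex more than a simplex *)

Section Neighborly.

Variables (V : finType) (L : {set {set V}}) (rk : {set V} -> nat).
Hypothesis grL : graded_lattice L rk.
Hypothesis nbL : neighborly_lattice L rk.
Implicit Types (G H K R S U W A B : {set V}) (x y z a b c u v w : V).

Local Notation facets := (facets L rk).

(** 2-neighborliness enters here: the pair of [x] and [y] is a face, so [facet_avoiding] applies to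
    it. *)
Lemma facet_avoiding_pair G x y z : G \in L -> x \in G -> y \in G -> z \in G ->
    x != z -> y != z ->
  exists2 K, K \in facets G & [&& x \in K, y \in K & z \notin K].
Proof.
move=> GL xG yG zG xz yz.
have xyG : [set x; y] \subset G.
  by apply/subsetP=> u; rewrite !inE => /orP[]/eqP->.
have [] := facet_avoiding grL (proj1 (nbL x y)) GL xyG zG.
  by rewrite !inE negb_or eq_sym xz eq_sym.
move=> K KF /andP[/subsetP xyK zK]; exists K => //.
by rewrite zK !xyK // !inE eqxx ?orbT.
Qed.

(** Given two facets avoiding [c], pick for each a vertex other than [c] that it misses; a facet
    through these two vertices that avoids [c] differs from both. Starting from one facet taken
    twice, this yields three. *)
Lemma card_facets_avoiding_gt2 G c : G \in L -> c \in G ->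
    (forall K, K \in facets G -> c \notin K -> exists2 y, y \in G :\ c & y \notin K) ->
  2 < #|[set K in facets G | c \notin K]|.
Proof.
move=> GL cG miss; set D := [set _ in _ | _].
have DP K : K \in D -> exists2 y, y \in G :\ c & y \notin K.
  by rewrite inE => /andP[]; apply: miss.
have third K1 K2 : K1 \in D -> K2 \in D ->
    exists2 K, K \in D & (K != K1) && (K != K2).
  move=> /DP[y1 + y1K] /DP[y2 + y2K]; rewrite !inE => /andP[y1c y1G] /andP[y2c y2G].
  have [K KF /and3P[y1K' y2K' cK]] := facet_avoiding_pair GL y1G y2G cG y1c y2c.
  exists K; first by rewrite inE KF.
  by apply/andP; split; [apply: contraNneq y1K => <- | apply: contraNneq y2K => <-].
have [|K1 K1F /andP[_ cK1]] := facet_avoiding grL (graded_set0 grL) GL (sub0set G) cG.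
  by rewrite inE.
have K1D : K1 \in D by rewrite inE K1F.
have [K2 K2D /andP[K21 _]] := third _ _ K1D K1D.
have [K3 K3D /andP[K31 K32]] := third _ _ K1D K2D.
have <- : #|[set K1; K2; K3]| = 3.
  rewrite setUC cardsU1 cards2 !inE negb_or K31 K32.
  by rewrite eq_sym K21.
apply: subset_leq_card; apply/subsetP=> K; rewrite !inE.
by move=> /orP[/orP[]|] /eqP->; move: K1D K2D K3D; rewrite !inE.
Qed.

(** By [rk_le_card] a facet has at least [rk G - 1] of the [rk G + 1] vertices, so it misses one or
    two. *)
Lemma almost_simplex_cofacet G H : G \in L -> #|G| = (rk G).+1 -> H \in facets G ->
  (exists2 u, u \in G & H = G :\ u) \/
  (exists x y, [/\ x != y, x \in G, y \in G & H = G :\: [set x; y]]).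
Proof.
move=> GL cG /facetP[HL HG rH].
have eH : H = G :\: (G :\: H).
  by rewrite setDDr setDv set0U; apply/esym/setIidPr/proper_sub.
have cH : #|G :\: H| + #|H| = #|G|.
  by rewrite cardsD (setIidPr (proper_sub HG)) subnK // subset_leq_card // proper_sub.
have := rk_le_card grL HL; have := proper_card HG => cH1 cH2.
have subGH u : u \in G :\: H -> u \in G by rewrite inE => /andP[].
have [c1|c1] := eqVneq #|G :\: H| 1.
  move/eqP/cards1P: c1 => [u eu]; left; exists u; last by rewrite eH eu.
  by apply: subGH; rewrite eu inE.
move/eqP in c1.
have /eqP/cards2P[x [y [xy exy]]] : #|G :\: H| = 2 by card_lia.
right; exists x, y; split=> //; last by rewrite eH exy.
  by apply: subGH; rewrite exy !inE eqxx.
by apply: subGH; rewrite exy !inE eqxx orbT.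
Qed.

(** Intersecting the facets [G :\ x] one after another removes one vertex at a time, and each
    removal lowers the rank. *)
Lemma almost_simplex_apexes G S : G \in L -> S \subset G ->
    (forall x, x \in S -> G :\ x \in facets G) ->
  G :\: S \in L /\ rk (G :\: S) + #|S| <= rk G.
Proof.
move=> GL; have [n] := ubnP #|S|; elim: n S => // n IH S cS SG SF.
have [->|/set0Pn[x xS]] := eqVneq S set0.
  by rewrite setD0 cards0 addn0; split.
have cSx := cardsD1 x S; rewrite xS in cSx.
have [|||G'L rG'] := IH (S :\ x).
- by card_lia.
- exact: subset_trans (subD1set _ _) SG.
- by move=> y; rewrite inE => /andP[_]; apply: SF.
have /facetP[xL _ _] := SF x xS.
have eGS : G :\: S = (G :\: (S :\ x)) :&: (G :\ x).
  apply/setP=> y; rewrite !inE; have [->|yx] := eqVneq y x;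
    first by rewrite xS /= ?andbF.
  by rewrite /=; case: (y \in S); case: (y \in G).
have GSL : G :\: S \in L by rewrite eGS; apply: (graded_setI grL).
split=> //; have : G :\: S \proper G :\: (S :\ x).
  apply/properP; split; first by rewrite eGS subsetIl.
  by exists x; rewrite !inE ?eqxx ?xS // (subsetP SG).
by move/(graded_rk grL GSL G'L); card_lia.
Qed.

(* The pairs of vertices missed by a facet form a graph in which every triple
   containing an edge contains exactly two edges, since the ridges of a simplex
   facet lie in two facets; such a graph is complete bipartite, with parts A
   and B. *)
Lemma almost_simplex_facets G : G \in L -> #|G| = (rk G).+1 ->
  exists A B, [/\ A \subset G, B \subset G, [disjoint A & B],
    2 < #|A| /\ 2 < #|B| &
    facets G = [set G :\ u | u in G :\: (A :|: B)] :|: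
               [set G :\: [set p.1; p.2] | p in setX A B]].
Proof.
move=> GL cG; pose E x y := G :\: [set x; y] \in facets G.
have EC x y : E x y = E y x by rewrite /E setUC.
(* [E] is the graph of missed pairs and [W] the set of vertices that are not apexes. An end of an
   edge is never an apex, because no facet contains another ([EW]). *)
pose W := [set x in G | G :\ x \notin facets G].
have EW x y : x != y -> x \in G -> y \in G -> E x y -> x \in W.
  move=> xy xG yG Exy; rewrite inE xG /=; apply: contraL (Exy) => xF.
  apply/negP=> /(eq_facet grL) => /(_ _ xF).
  rewrite setDS ?sub1set ?inE ?eqxx // => /(_ isT) /setP/(_ y).
  by rewrite !inE eqxx orbT yG eq_sym xy.
have cofacet H : H \in facets G ->
    (exists2 u, u \in G :\: W & H = G :\ u) \/
    (exists x y, [/\ x != y, x \in W, y \in W & H = G :\: [set x; y]]).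
  move=> HF; case: (almost_simplex_cofacet GL cG HF) => [[u uG eH]|[x [y [xy xG yG
    eH]]]].
    by left; exists u => //; rewrite !inE uG -eH HF.
  have Exy : E x y by rewrite /E -eH.
  right; exists x, y; split=> //; first exact: (EW x y).
  by apply: (EW y x); rewrite // 1?eq_sym // EC.
have EE x y z : x != y -> z != x -> z != y -> x \in W -> y \in W -> z \in W ->
    E x y -> E x z != E y z.
  move=> xy zx zy xW yW zW Exy.
  have [xG yG zG] : [/\ x \in G, y \in G & z \in G].
    by move: xW yW zW; rewrite !inE => /andP[-> _] /andP[-> _] /andP[-> _].
  have /facetP[HL HG rH] := Exy; set H := G :\: [set x; y] in HL HG rH *.
  have xyG : [set x; y] \subset G.
    by apply/subsetP=> u; rewrite !inE => /orP[]/eqP->.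
  have cH : #|H| = rk H.
    by have := cardsD G [set x; y]; rewrite -/H (setIidPr xyG) cards2 xy /=; card_lia.
  have zH : z \in H by rewrite !inE negb_or zx zy.
  have RF := simplex_facet grL HL cH zH; set R := H :\ z in RF.
  have /facetP[RL RH rR] := RF.
  apply/eqP=> Ezz; have [Exz|nExz] := boolP (E x z).
    have Eyz : E y z by rewrite -Ezz.
    have : #|[set K in facets G | R \subset K]| = 2.
      by apply: card_ridge_facets; rewrite ?(proper_trans RH HG) //; card_lia.
    set K1 := G :\: [set x; z]; set K2 := G :\: [set y; z] => cR.
    have HK1 : H != K1 by apply: contraTneq zH => ->; rewrite !inE eqxx orbT.
    have HK2 : H != K2 by apply: contraTneq zH => ->; rewrite !inE eqxx orbT.
    have K12 : K1 != K2.
      have xK1 : x \notin K1 by rewrite !inE eqxx.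
      by apply: contraNneq xK1 => ->; rewrite !inE xG negb_or xy eq_sym zx.
    have : #|[set H; K1; K2]| = 3.
      by rewrite setUC cardsU1 cards2 !inE negb_or HK1 ![K2 == _]eq_sym HK2 K12.
    suff /subset_leq_card : [set H; K1; K2] \subset [set K in facets G | R \subset K].
      by rewrite cR => + e3; rewrite e3.
    apply/subsetP=> K; rewrite in_setU in_set1 in_set2 in_set.
    move=> /orP[/orP[]|] /eqP->; apply/andP; split=> //; first exact: subD1set.
      by apply/subsetP=> u; rewrite !inE !negb_or => /and3P[-> /andP[-> _] ->].
    by apply/subsetP=> u; rewrite !inE !negb_or => /and3P[-> /andP[_ ->] ->].
  (* If neither [x] nor [y] were adjacent to [z]: the second facet through [R] misses [z] and
     otherwise at most [x] and [y]. It is not [G :\ z], as [z] lies in [W], so it makes [z] adjacent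
     to [x] or [y]. *)
  have [K KF KH] := facet_of_facet grL GL Exy RF.
  have zK : z \notin K.
    apply/negP=> zK; have : z \in R by rewrite -KH inE zK.
    by rewrite !inE eqxx.
  have uKH u : u \in G -> u \notin K -> u \in [set x; y; z].
    move=> uG uK; have : u \notin R by rewrite -KH inE (negPf uK).
    by rewrite !inE uG andbT negb_and !negbK orbC.
  have exK u : u != z -> u \in W -> K = G :\: [set z; u] -> False.
    move=> uz uW eK; have uG : u \in G by move: uW; rewrite inE => /andP[].
    have : u \in [set x; y; z] by apply: uKH => //; rewrite eK !inE eqxx orbT.
    rewrite !inE (negPf uz) orbF => /orP[]/eqP eu; subst u.
      by case/negP: nExz; rewrite EC /E -eK.
    by case/negP: nExz; rewrite Ezz EC /E -eK.
  case: (cofacet _ KF) => [[u uW eK]|[u [v [uv uW vW eK]]]].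
    move: zK; rewrite eK !inE zG andbT negbK => /eqP ezu.
    by move: uW; rewrite -ezu inE zW.
  move: zK; rewrite eK !inE zG andbT negbK => /orP[]/eqP ezu; subst z.
    by apply: (exK v); rewrite // eq_sym.
  by apply: (exK u); rewrite // setUC.
(* If every vertex were an apex, [almost_simplex_apexes] with [S = G] would give [#|G| <= rk G]. *)
have [x xW] : exists x, x \in W.
  apply/set0Pn/eqP=> W0.
  have [] := almost_simplex_apexes GL (subxx G); last by rewrite cG; card_lia.
  move=> x xG; move/setP/(_ x): W0; rewrite !inE xG /=.
  by move=> /negbFE.
have xG : x \in G by move: xW; rewrite inE => /andP[].
have Exx u : u \in W -> ~~ E u u.
  by rewrite inE => /andP[_]; rewrite /E setUid.
have [y yW Exy] : exists2 y, y \in W & E x y.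
  have [] := facet_avoiding grL (graded_set0 grL) GL (sub0set G) xG;
    first by rewrite inE.
  move=> H HF /andP[_ xH]; case: (cofacet _ HF) => [[u uW eH]|[u [v [uv uW vW eH]]]].
    move: xH; rewrite eH !inE xG andbT negbK => /eqP exu.
    by move: uW; rewrite -exu inE xW.
  move: xH; rewrite eH !inE xG andbT negbK => /orP[]/eqP exu; subst x.
    by exists v => //; rewrite /E -eH.
  by exists u => //; rewrite EC /E -eH.
(* The parts are the non-neighbors and the neighbors of [x]; the rule on triples makes both
   independent and joins them completely. *)
pose A := [set z in W | ~~ E x z]; pose B := [set z in W | E x z].
have xA : x \in A by rewrite inE xW Exx.
have yB : y \in B by rewrite inE yW.
have nAB a b : a \in A -> b \in B -> a != b.
  by rewrite !inE => /andP[_ Ea] /andP[_ Eb]; apply: contraNneq Ea => ->.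
have AW a : a \in A -> a \in W by rewrite inE => /andP[].
have BW b : b \in B -> b \in W by rewrite inE => /andP[].
have WG w : w \in W -> w \in G by rewrite inE => /andP[].
have EAB a b : a \in A -> b \in B -> E a b.
  move=> aA bB; have [->|ax] := eqVneq a x; first by move: bB; rewrite inE => /andP[].
  have Exb : E x b by move: bB; rewrite inE => /andP[].
  have := EE x b a (nAB _ _ xA bB) ax (nAB _ _ aA bB) xW (BW _ bB) (AW _ aA) Exb.
  by move: aA; rewrite inE => /andP[_ /negPf->]; rewrite EC; case: (E a b).
have EBB b b' : b \in B -> b' \in B -> ~~ E b b'.
  move=> bB b'B; have [->|bb] := eqVneq b' b; first by apply: Exx; apply: BW.
  have xb' : b' != x by rewrite eq_sym nAB.
  have := EE x b b' (nAB _ _ xA bB) xb' bb xW (BW _ bB) (BW _ b'B) (EAB _ _ xA bB).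
  by rewrite (EAB x b') //; case: (E b b').
have EAA a a' : a \in A -> a' \in A -> ~~ E a a'.
  move=> aA a'A; have [->|aa] := eqVneq a' a; first by apply: Exx; apply: AW.
  have := EE a y a' (nAB _ _ aA yB) aa (nAB _ _ a'A yB) (AW _ aA) yW (AW _ a'A) (EAB
    _ _ aA yB).
  by rewrite (EC y) (EAB a' y) //; case: (E a a').
have ABW : A :|: B = W.
  by apply/setP=> u; rewrite !inE; case: (E x u); rewrite ?andbT ?andbF ?orbF.
have facetsE H : H \in facets G -> (exists2 u, u \in G :\: W & H = G :\ u) \/
    (exists a b, [/\ a \in A, b \in B & H = G :\: [set a; b]]).
  move=> HF; case: (cofacet _ HF) => [|[u [v [uv uW vW eH]]]]; first by left.
  have Euv : E u v by rewrite /E -eH.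
  right; move: (uW) (vW); rewrite -ABW.
  rewrite [u \in _ :|: _]inE => /orP[uA|uB]; rewrite inE => /orP[vA|vB].
  - by case/negP: (EAA _ _ uA vA).
  - by exists u, v.
  - by exists v, u; rewrite setUC.
  - by case/negP: (EBB _ _ uB vB).
exists A, B; split.
- by apply/subsetP=> a /AW/WG.
- by apply/subsetP=> b /BW/WG.
- rewrite disjoints_subset; apply/subsetP=> a aA; rewrite inE.
  by apply/negP=> /(nAB a a aA); rewrite eqxx.
(* The facets avoiding [y] are the sets [G :\: [set a; y]] with [a] in [A], and there are at least
   three of them; [x] gives the bound on [B] in the same way. *)
- split.
    apply: leq_trans (card_facets_avoiding_gt2 GL (WG _ yW) _) _.
      move=> K /facetsE[[u uW ->]|[a [b [aA bB ->]]]].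
        rewrite !inE (WG _ yW) andbT negbK => /eqP yu.
        by move: uW; rewrite -yu inE yW.
      rewrite !inE (WG _ yW) andbT negbK => /orP[]/eqP yu.
        by have := nAB _ _ aA yB; rewrite yu eqxx.
      exists a; last by rewrite !inE eqxx.
      by rewrite !inE (WG _ (AW _ aA)) nAB.
    apply: leq_trans (leq_imset_card (fun a => G :\: [set a; y]) A).
    apply/subset_leq_card/subsetP=> K; rewrite inE => /andP[].
    move=> /facetsE[[u uW ->]|[a [b [aA bB ->]]]].
      rewrite !inE (WG _ yW) andbT negbK => /eqP yu.
      by move: uW; rewrite -yu inE yW.
    rewrite !inE (WG _ yW) andbT negbK => /orP[]/eqP yu.
      by have := nAB _ _ aA yB; rewrite yu eqxx.
    by rewrite -yu; apply/imsetP; exists a.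
  apply: leq_trans (card_facets_avoiding_gt2 GL (WG _ xW) _) _.
    move=> K /facetsE[[u uW ->]|[a [b [aA bB ->]]]].
      rewrite !inE (WG _ xW) andbT negbK => /eqP yu.
      by move: uW; rewrite -yu inE xW.
    rewrite !inE (WG _ xW) andbT negbK => /orP[]/eqP yu; last first.
      by have := nAB _ _ xA bB; rewrite yu eqxx.
    exists b; last by rewrite !inE eqxx orbT.
    by rewrite !inE (WG _ (BW _ bB)) eq_sym nAB.
  apply: leq_trans (leq_imset_card (fun b => G :\: [set x; b]) B).
  apply/subset_leq_card/subsetP=> K; rewrite inE => /andP[].
  move=> /facetsE[[u uW ->]|[a [b [aA bB ->]]]].
    rewrite !inE (WG _ xW) andbT negbK => /eqP yu.
    by move: uW; rewrite -yu inE xW.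
  rewrite !inE (WG _ xW) andbT negbK => /orP[]/eqP yu; last first.
    by have := nAB _ _ xA bB; rewrite yu eqxx.
  by rewrite -yu; apply/imsetP; exists b.
apply/setP=> H; rewrite ABW [RHS]inE.
apply/idP/orP => [/facetsE[[u uW ->]|[a [b [aA bB ->]]]]|].
- by left; apply: imset_f.
- by right; apply/imsetP; exists (a, b); rewrite ?in_setX ?aA.
case=> /imsetP[]; first by move=> u; rewrite !inE => + ->; case: (u \in G) => //=;
  rewrite andbT negbK.
by case=> a b; rewrite in_setX => /andP[aA bB] ->; apply: EAB.
Qed.

End Neighborly.

(** * Counting facets *)

Lemma sum_card_incidence (V : finType) (A : {set V}) (F : {set {set V}}) :
  \sum_(x in A) #|[set K in F | x \in K]| = \sum_(K in F) #|A :&: K|.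
Proof.
transitivity (\sum_(x in A) \sum_(K in F) (x \in K : nat)).
  apply: eq_bigr => x _; rewrite -sum1dep_card big_mkcondr.
  by apply: eq_bigr => K _; case: ifP.
rewrite exchange_big; apply: eq_bigr => K _; rewrite -sum1_card big_mkcond /=.
by rewrite [RHS]big_mkcond; apply: eq_bigr => x _; rewrite inE; do 2!case: (x \in _).
Qed.

Section FacetCount.

Variables (V : finType) (L : {set {set V}}) (rk : {set V} -> nat).
Hypothesis grL : graded_lattice L rk.
Hypothesis nbL : neighborly_lattice L rk.
Implicit Types (G H K R S U W A B : {set V}) (x y z a b c u v w : V).

Local Notation facets := (facets L rk).

(** Every ridge is counted twice, once for each of the two facets through it. *)
Lemma even_sum_card_facets G : G \in L ->
  ~~ odd (\sum_(H in facets G) #|facets H|).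
Proof.
move=> GL; have -> : \sum_(H in facets G) #|facets H| =
    \sum_R #|[set H in facets G | R \in facets H]|.
  transitivity (\sum_(H in facets G) \sum_R (R \in facets H : nat)).
    apply: eq_bigr => H _; rewrite -sum1_card big_mkcond.
    by apply: eq_bigr => R _; case: ifP.
  rewrite exchange_big; apply: eq_bigr => R _; rewrite -sum1dep_card big_mkcondr.
  by apply: eq_bigr => H _; case: ifP.
apply: (big_ind (fun n => ~~ odd n)) => // [m n|R _]; first by rewrite oddD;
  do 2!case: odd.
set D := [set _ in _ | _]; have [->|/set0Pn[H]] := eqVneq D set0;
  first by rewrite cards0.
rewrite inE => /andP[/facetP[HL HG rH] /facetP[RL RH rR]].
have rG : rk G = (rk R).+2 by rewrite rR.
suff -> : D = [set K in facets G | R \subset K].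
  by rewrite card_ridge_facets // (proper_trans RH HG).
apply/setP=> K; rewrite !inE; apply/andb_id2l => /facetP[KL KG rK].
apply/facetP/idP => [[_ /proper_sub //]|RK]; split=> //; last by rewrite rR; card_lia.
by rewrite properEneq RK andbT; apply: contra_eqN rK => /eqP<-; apply/eqP; card_lia.
Qed.

Lemma odd_card_facets G : G \in L ->
  (forall H, H \in facets G -> odd #|facets H|) -> ~~ odd #|facets G|.
Proof.
move=> GL oddF; have := even_sum_card_facets GL.
rewrite -sum1_card !(big_morph odd oddD (erefl _)).
by rewrite (eq_bigr (fun=> true)) // => H /oddF ->.
Qed.

Lemma almost_simplex_card_facets G A B : A \subset G -> B \subset G ->
    [disjoint A & B] -> facets G = [set G :\ u | u in G :\: (A :|: B)] :|:
               [set G :\: [set p.1; p.2] | p in setX A B] ->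
  #|facets G| = #|G :\: (A :|: B)| + #|A| * #|B|.
Proof.
move=> AG BG dAB ->; rewrite cardsU disjoint_setI0 ?cards0 ?subn0; last first.
  rewrite disjoints_subset; apply/subsetP=> _ /imsetP[u uU ->]; rewrite inE.
  apply/imsetP=> -[[a b]]; rewrite inE /= => /andP[aA bB] eu.
  have /setP/(_ u) := eu; rewrite !inE eqxx /=.
  move: uU; rewrite !inE negb_or => /andP[/andP[uA uB] uG].
  rewrite uG andbT => /esym/negbFE/orP[]/eqP ueq; subst u.
    by rewrite aA in uA.
  by rewrite bB in uB.
rewrite card_in_imset ?card_in_imset ?cardsX //.
  move=> [a b] [a' b']; rewrite !inE /= => /andP[aA bB] /andP[a'A b'B] /setP e.
  have mem u : u \in G -> u \in [set a; b] -> u \in [set a'; b'].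
    by move=> uG uab; have := e u; rewrite !in_setD uG uab /= andbT => /esym/negbFE.
  have := mem a (subsetP AG _ aA); have := mem b (subsetP BG _ bB).
  rewrite !inE !eqxx orbT => /(_ isT)/orP[]/eqP eb.
    by move: bB; rewrite eb (disjointFr dAB a'A).
  move=> /(_ isT)/orP[]/eqP ea; first by rewrite ea eb.
  by move: b'B; rewrite -ea (disjointFr dAB aA).
move=> u v; rewrite !inE => /andP[_ uG] _ /setP/(_ u).
by rewrite !inE eqxx uG !andbT /= => /esym/negbFE/eqP.
Qed.

(** Count pairs of a vertex [y] other than [x] and a facet through both: each edge at [x] lies in at
    least [rk G - 2] facets, and each facet at [x] contains exactly [rk G - 2] other vertices. *)
Lemma simplicial_degree G x : G \in L -> x \in G -> 2 < rk G ->
    (forall K, K \in facets G -> (#|K|).+1 = rk G) ->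
  #|G| <= #|[set K in facets G | x \in K]| .+1.
Proof.
move=> GL xG rG2 simp; set D := [set _ in _ | _].
have cG := cardsD1 x G; rewrite xG add1n in cG; rewrite cG ltnS.
have r0 : 0 < rk G - 2 by rewrite subn_gt0.
rewrite -(leq_pmul2r r0) -sum_nat_const -sum_nat_const.
have -> : \sum_(K in D) (rk G - 2) = \sum_(K in D) #|(G :\ x) :&: K|.
  apply: eq_bigr => K; rewrite inE => /andP[KF xK].
  have /facetP[_ /proper_sub KG _] := KF.
  have -> : (G :\ x) :&: K = K :\ x.
    apply/setP=> y; rewrite !inE; case yK: (y \in K); last by rewrite !andbF.
    by rewrite (subsetP KG _ yK) !andbT.
  by have := cardsD1 x K; rewrite xK -(simp K KF); card_lia.
rewrite -sum_card_incidence; apply: leq_sum => y; rewrite !inE => /andP[yx yG].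
have [xyL rxy] := nbL x y; rewrite eq_sym yx in rxy.
have xyG : [set x; y] \subset G by apply/subsetP=> u; rewrite !inE => /orP[]/eqP->.
rewrite -{1}rxy; apply: leq_trans (rk_codim_le grL xyL GL xyG) _.
apply/subset_leq_card/subsetP=> K; rewrite !inE => /andP[-> /subsetP xyK].
by rewrite !xyK // !inE eqxx ?orbT.
Qed.

(** Count incidences: every vertex lies in at least [#|G| - 1] facets, and every facet has
    [rk G - 1] vertices. *)
Lemma simplicial_card_facets G : G \in L -> 2 < rk G ->
    (forall K, K \in facets G -> (#|K|).+1 = rk G) ->
  #|G| * #|G|.-1 <= #|facets G| * (rk G).-1.
Proof.
move=> GL rG2 simp; rewrite -sum_nat_const -[X in _ <= X]sum_nat_const.
have -> : \sum_(K in facets G) (rk G).-1 = \sum_(K in facets G) #|G :&: K|.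
  apply: eq_bigr => K KF; have /facetP[_ /proper_sub KG _] := KF.
  by rewrite (setIidPr KG) -(simp K KF).
rewrite -sum_card_incidence; apply: leq_sum => x xG.
by have := simplicial_degree GL xG rG2 simp; card_lia.
Qed.

(** Count incidences of vertices outside [H]. Each of the at least [rk G - 1] facets sharing a ridge
    with [H] has at most one such vertex, and every remaining facet has at most [#|G :\: H|]. *)
Lemma simplicial_card_outside G H : G \in L -> 2 < rk G ->
    (forall K, K \in facets G -> (#|K|).+1 = rk G) -> H \in facets G ->
  #|G :\: H| * #|G|.-1 <= (rk G).-1 + #|G :\: H| * (#|facets G| - rk G).
Proof.
move=> GL rG2 simp HF; have /facetP[HL HG rH] := HF.
set k := #|_ :\: _|; pose D := [set K in facets G | K :&: H \in facets H].
have k0 : 0 < k by case/properP: HG => _ [x xG xH]; apply/card_gt0P; exists x;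
  rewrite inE xH.
have cH : #|H| = rk H by have := simp H HF; card_lia.
have rD : (rk G).-1 <= #|D|.
  rewrite -rH /= -(card_facets_simplex grL HL cH).
  apply: leq_trans (leq_imset_card (fun K => K :&: H) D).
  apply/subset_leq_card/subsetP=> R RF.
  have [K KF KH] := facet_of_facet grL GL HF RF.
  by apply/imsetP; exists K; rewrite ?inE ?KF ?KH.
have HD : H \notin D.
  rewrite inE HF setIid; apply/negP=> /facetP[_]; by rewrite properxx.
have DH : D \subset facets G :\ H.
  apply/subsetP=> K KD; rewrite in_setD1; apply/andP; split.
    by apply: contraNneq HD => <-.
  by move: KD; rewrite inE => /andP[].
have cDH := cardsD D (facets G :\ H).
have mG := cardsD1 H (facets G); rewrite HF in mG.
have cE := cardsID D (facets G :\ H); rewrite (setIidPr DH) in cE.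
have le1 : k * #|G|.-1 <= \sum_(K in facets G) #|(G :\: H) :&: K|.
  rewrite -sum_card_incidence -sum_nat_const; apply: leq_sum => x.
  rewrite inE => /andP[_ xG].
  by have := simplicial_degree GL xG rG2 simp; card_lia.
apply: (leq_trans le1); rewrite (bigD1 H) //=.
rewrite [#|_ :&: _|](_ : _ = 0) ?add0n; last first.
  by apply: eq_card0 => x; rewrite !inE; case: (x \in H); rewrite ?andbF.
have -> : \sum_(K in facets G | K != H) #|(G :\: H) :&: K| =
          \sum_(K in facets G :\ H) #|(G :\: H) :&: K|.
  by apply: eq_bigl => K; rewrite in_setD1 andbC.
rewrite (big_setID D) /= (setIidPr DH).
have le2 : \sum_(K in D) #|(G :\: H) :&: K| <= #|D|.
  rewrite -sum1_card; apply: leq_sum => K; rewrite inE => /andP[KF /facetP[RL _ rR]].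
  have := rk_le_card grL RL; have := cardsID H K; have := simp K KF.
  have : #|(G :\: H) :&: K| <= #|K :\: H|.
    by apply/subset_leq_card/subsetP=> x; rewrite !inE => /andP[/andP[-> _] ->].
  card_lia.
have le3 : \sum_(K in facets G :\ H :\: D) #|(G :\: H) :&: K| <=
           #|facets G :\ H :\: D| * k.
  rewrite -sum_nat_const; apply: leq_sum => K _.
  by apply/subset_leq_card/subsetIl.
apply: leq_trans (leq_add le2 le3) _.
move: k0 rD cE mG rG2; rewrite (mulnC _ k).
move: (#|_ :\: D|) (#|facets G|) (#|_ :\ H|) (#|D|) (rk G) => e m f n r.
clear=> k0 rn ef mf r2; have -> : m - r = e + (n - r.-1) by lia.
by rewrite mulnDr; have := leq_pmull (n - r.-1) k0; lia.
Qed.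

Lemma simplicial_many_facets G : G \in L -> 2 < rk G -> rk G + 2 <= #|G| ->
    (forall K, K \in facets G -> (#|K|).+1 = rk G) ->
  rk G + 6 <= #|facets G|.
Proof.
move=> GL rG2 cG simp; rewrite leqNgt; apply/negP=> mG.
have c1 := simplicial_card_facets GL rG2 simp.
have [|H HF _] := exists_facet grL (graded_set0 grL) GL.
  by rewrite proper0 -card_gt0; card_lia.
have /facetP[_ /proper_sub HG _] := HF.
have c2 := simplicial_card_outside GL rG2 simp HF.
have cH := simp H HF; have := cardsID H G; rewrite (setIidPr HG).
move: rG2 cG mG c1 c2 cH; set m := #|facets G|; set k := #|_ :\: _|.
move: (#|G|) (#|H|) (rk G) m k => v h r m k rG2 cG mG c1 c2 cH ch.
clear -rG2 cG mG c1 c2 cH ch.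
(* For [r < 7] the first count suffices: [(r + 2)(r + 1) <= (r + 5)(r - 1)] means [r >= 7]. *)
have [r6|r6] := leqP 7 r; last first.
  have : (r + 2) * (r + 1) <= (r + 5) * r.-1.
    by apply: leq_trans (leq_trans c1 _); apply: leq_mul; lia.
  by move: r6 rG2; clear; case: r => [|[|[|[|[|[|[|r]]]]]]] //; lia.
(* For [r >= 7], the second count with [v - 1 = (r - 7) + 5 + k] and [m - r <= 5] reduces to
   [k (r - 7) + k * k <= r - 1], which fails for [k >= 3]. *)
have k3 : 3 <= k by lia.
have k5 : k * (m - r) <= k * 5 by rewrite leq_mul2l; lia.
have kk : 3 * 3 <= k * k by apply: leq_mul.
have kr : 3 * (r - 7) <= k * (r - 7) by rewrite leq_mul2r k3 orbT.
move: c2; have -> : v.-1 = (r - 7) + 5 + k by lia.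
by rewrite !mulnDr; lia.
Qed.

End FacetCount.

(** * The nonsimplicial case and the induction on the rank *)

Section ManyFacets.

Variables (V : finType) (L : {set {set V}}) (rk : {set V} -> nat).
Hypothesis grL : graded_lattice L rk.
Hypothesis nbL : neighborly_lattice L rk.
Implicit Types (F G H K R S U W A B : {set V}) (x y z a b c u v w : V).

Local Notation facets := (facets L rk).

(* F is a direct sum of two triangles A and B, and the 9 other facets K of G
   are indexed by A x B through K :&: F = F :\: [set a; b].  If three vertices
   lie outside F, any two of them are in at least 4 of these facets, but no
   facet has room for three: 3 * 4 > 9.  If w, w' are the only vertices outside
   F, each is missed in at least two of the three rows of A x B; in a common
   row, a facet missing w is a simplex, and its neighbor across the ridge
   opposite b' contains w'. *)
Lemma no_ten_facets G F A B : G \in L -> F \in facets G -> rk G = 6 ->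
    8 <= #|G| -> (forall K, K \in facets G -> #|K| <= 6) -> #|facets G| = 10 ->
    A :|: B = F -> [disjoint A & B] -> #|A| = 3 -> #|B| = 3 ->
    facets F = [set F :\: [set p.1; p.2] | p in setX A B] -> False.
Proof.
move=> GL FF rG cG cK mG eF dAB cA cB fF.
have /facetP[FL FG rF] := FF.
have cF : #|F| = 6 by rewrite -eF cardsU disjoint_setI0 // cards0 cA cB.
have mF : #|facets F| = 9.
  rewrite (almost_simplex_card_facets (L := L) (rk := rk) (G := F) (A := A) (B :=
    B)) -?eF ?subsetUl ?subsetUr //.
    by rewrite setDv cards0 cA cB.
  rewrite eF fF setDv; apply/setP=> K; rewrite [RHS]inE;
    apply/idP/orP=> [|[/imsetP[x]|//]]; first by right.
  by rewrite inE.
have AF a : a \in A -> a \in F by rewrite -eF inE => ->.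
have BF b : b \in B -> b \in F by rewrite -eF inE orbC => ->.
have nAB a b : a \in A -> b \in B -> a != b.
  by move=> aA; apply: contraTneq => <-; rewrite (disjointFr dAB aA).
have mGF := cardsD1 F (facets G); rewrite FF mG in mGF.
have m9 : #|facets G :\ F| = 9 by move: mGF; rewrite add1n => -[<-].
have tr : facets F \subset [set K :&: F | K in facets G :\ F].
  apply/subsetP=> R RF; have [K KF KH] := facet_of_facet grL GL FF RF.
  apply/imsetP; exists K => //; rewrite in_setD1 KF andbT.
  by apply/eqP=> KeF; move: RF; rewrite -KH KeF setIid => /facetP[_]; rewrite properxx.
(* [F] has 9 facets and only 9 other facets of [G] are available to cut them out, so the
   correspondence is bijective and every other facet of [G] shares a ridge with [F]. *)
have trE : facets F = [set K :&: F | K in facets G :\ F].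
  apply/eqP; rewrite eqEcard tr mF; by apply: leq_trans (leq_imset_card _ _) _;
    rewrite m9.
have cell K : K \in facets G -> K != F ->
    exists a b, [/\ a \in A, b \in B & K :&: F = F :\: [set a; b]].
  move=> KF nK; have : K :&: F \in facets F.
    by rewrite trE; apply: imset_f; rewrite in_setD1 nK.
  by rewrite fF => /imsetP[[a b]]; rewrite in_setX => /andP[aA bB] ->; exists a, b.
have cell_inj K K' : K \in facets G -> K' \in facets G -> K != F -> K' != F ->
    K :&: F = K' :&: F -> K = K'.
  move=> KF K'F nK nK' e.
  have /imset_injP inj : #|[set K :&: F | K in facets G :\ F]| == #|facets G :\ F|.
    by rewrite -trE mF m9.
  by apply: inj; rewrite ?in_setD1 ?nK ?nK'.
have card_cell a b : a \in A -> b \in B -> #|F :\: [set a; b]| = 4.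
  move=> aA bB; rewrite cardsD cF (setIidPr _) ?cards2 ?nAB //.
  by apply/subsetP=> u; rewrite !inE => /orP[]/eqP->; [apply: AF | apply: BF].
have outF w : w \in G :\: F -> w \in G /\ w \notin F by rewrite inE => /andP[].
have cW := cardsID F G; rewrite (setIidPr (proper_sub FG)) cF in cW.
have [c3|c2] := ltnP 2 #|G :\: F|.
  have [w1 [w2 [w3 [[w1W w2W w3W] [w12 w23 w31]]]]] := card_gt2P c3.
  pose at2 w w' := [set K in facets G :\ F | (w \in K) && (w' \in K)].
  have at4 w w' : w \in G :\: F -> w' \in G :\: F -> w != w' -> 4 <= #|at2 w w'|.
    move=> /outF[wG wF] /outF[w'G w'F] ww'.
    have [ewL erw] := nbL w w'; rewrite ww' in erw.
    have wwG : [set w; w'] \subset G by apply/subsetP=> u; rewrite !inE => /orP[]/eqP->.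
    have := rk_codim_le grL ewL GL wwG; rewrite rG erw; move/leq_trans; apply.
    apply/subset_leq_card/subsetP=> K; rewrite inE => /andP[KF /subsetP wwK].
    have wK : w \in K by rewrite wwK // !inE eqxx.
    have w'K : w' \in K by rewrite wwK // !inE eqxx orbT.
    rewrite inE in_setD1 KF wK w'K !andbT.
    by apply: contraNneq wF => <-.
  have no3 K : K \in facets G -> K != F -> w1 \in K -> w2 \in K -> w3 \in K -> False.
    move=> KF nK w1K w2K w3K; have [a [b [aA bB eK]]] := cell K KF nK.
    have : [set w1; w2; w3] \subset K :\: F.
      apply/subsetP=> u; rewrite !inE => /orP[/orP[]|] /eqP->.
      - by rewrite w1K (proj2 (outF _ w1W)).
      - by rewrite w2K (proj2 (outF _ w2W)).
      - by rewrite w3K (proj2 (outF _ w3W)).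
    move/subset_leq_card;
      rewrite setUC cardsU1 cards2 !inE negb_or w31 eq_sym w23 w12 /=.
    by have := cardsID F K; rewrite eK card_cell //; have := cK K KF; card_lia.
  have d12 : [disjoint at2 w1 w2 & at2 w2 w3 :|: at2 w1 w3].
    rewrite disjoints_subset; apply/subsetP=> K;
      rewrite !inE => /andP[/andP[nK KF] /andP[w1K w2K]].
    by apply/negP=> /orP[]/andP[_ /andP[_ w3K]]; apply: (no3 K).
  have d23 : [disjoint at2 w2 w3 & at2 w1 w3].
    rewrite disjoints_subset; apply/subsetP=> K;
      rewrite !inE => /andP[/andP[nK KF] /andP[w2K w3K]].
    by apply/negP=> /andP[_ /andP[w1K _]]; apply: (no3 K).
  have : #|at2 w1 w2 :|: (at2 w2 w3 :|: at2 w1 w3)| <= #|facets G :\ F|.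
    apply/subset_leq_card/subsetP=> K; rewrite !in_setU.
    by move=> /or3P[]; rewrite inE => /andP[].
  rewrite cardsU (disjoint_setI0 d12) cardsU (disjoint_setI0 d23) !cards0 !subn0.
  have := at4 _ _ w1W w2W w12; have := at4 _ _ w2W w3W w23.
  have w13 : w1 != w3 by rewrite eq_sym.
  have := at4 _ _ w1W w3W w13; card_lia.
pose misses w := [set a in A | [exists b in B, [exists K in facets G,
   (K :&: F == F :\: [set a; b]) && (w \notin K)]]].
have missesP w a : a \in misses w -> exists b K,
    [/\ a \in A, b \in B, K \in facets G, K :&: F = F :\: [set a; b] & w \notin K].
  rewrite inE => /andP[aA /existsP[b /andP[bB /existsP[K /andP[KF /andP[/eqP eK
    wK]]]]]].
  by exists b, K.
(* A facet through [w'] and [a] that avoids [w] lies in a row other than [a]; hence no single row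
   contains all the facets missing [w]. *)
have misses2 w w' : w \in G :\: F -> w' \in G :\: F -> w != w' -> 2 <= #|misses w|.
  move=> /outF[wG wF] /outF[w'G w'F] ww'.
  have other a : a \in A -> exists2 a', a' \in misses w & a' != a.
    move=> aA; have aF := AF a aA; have aG := subsetP (proper_sub FG) _ aF.
    have [||K KF /and3P[w'K aK wK]] := facet_avoiding_pair grL nbL GL w'G aG wG.
    - by rewrite eq_sym.
    - by apply: contraNneq wF => <-.
    have nK : K != F by apply: contraNneq w'F => <-.
    have [a' [b [a'A bB eK]]] := cell K KF nK; exists a'.
      rewrite inE a'A; apply/existsP; exists b; rewrite bB; apply/existsP; exists K.
      by rewrite KF eK eqxx.
    have : a \in K :&: F by rewrite inE aK.
    by rewrite eK !inE negb_or eq_sym => /andP[/andP[]].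
  have [a aA] : exists a, a \in A by apply/card_gt0P; rewrite cA.
  have [a1 a1m _] := other a aA; have [_ [_ [a1A _ _ _ _]]] := missesP _ _ a1m.
  have [a2 a2m a21] := other a1 a1A.
  by apply/card_gt1P; exists a1, a2; rewrite eq_sym.
have /eqP/cards2P[w [w' [ww' eW]]] : #|G :\: F| = 2 by card_lia.
have wW : w \in G :\: F by rewrite eW !inE eqxx.
have w'W : w' \in G :\: F by rewrite eW !inE eqxx orbT.
have [a] : exists a, a \in misses w :&: misses w'.
  apply/card_gt0P; have := misses2 _ _ wW w'W ww'.
  have := misses2 _ _ w'W wW; rewrite eq_sym ww' => /(_ isT).
  have := cardsUI (misses w) (misses w').
  have : #|misses w :|: misses w'| <= #|A|.
    by apply/subset_leq_card/subsetP=> u; rewrite !inE => /orP[]/andP[].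
  rewrite cA; card_lia.
case/setIP=> /missesP[b [K1 [aA bB K1F eK1 wK1]]].
move=> /missesP[b' [K2 [_ b'B K2F eK2 w'K2]]].
have [wG wF] := outF _ wW; have [w'G w'F] := outF _ w'W.
have nF a' b0 K : a' \in A -> K :&: F = F :\: [set a'; b0] -> K != F.
  move=> a'A eK; apply/eqP=> KF; move/setP/(_ a'): eK.
  by rewrite KF setIid !inE eqxx AF.
have nK1 := nF _ _ _ aA eK1; have nK2 := nF _ _ _ aA eK2.
have K1W : K1 :\: F \subset [set w'].
  apply/subsetP=> u; rewrite in_setD => /andP[uF uK1].
  have /facetP[_ /proper_sub/subsetP K1G _] := K1F.
  have : u \in G :\: F by rewrite inE uF K1G.
  by rewrite eW !inE => /orP[]/eqP eu; [rewrite -eu uK1 in wK1 | rewrite eu].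
have /facetP[K1L K1G rK1] := K1F.
have cK1 := cardsID F K1; rewrite eK1 card_cell // in cK1.
have cK1W := subset_leq_card K1W; rewrite cards1 in cK1W.
have cK1rk := rk_le_card grL K1L.
have w'K1 : w' \in K1.
  have /card_gt0P[u uW] : 0 < #|K1 :\: F| by card_lia.
  have := subsetP K1W _ uW; rewrite inE => /eqP eu.
  by move: uW; rewrite eu inE => /andP[].
have bb' : b' != b.
  apply: contraNneq w'K2 => eb; rewrite -(cell_inj K1 K2) // eK1 eK2 eb //.
have b'K1 : b' \in K1.
  have : b' \in K1 :&: F by rewrite eK1 !inE negb_or bb' BF // eq_sym nAB.
  by rewrite inE => /andP[].
have cK1' : #|K1| = rk K1 by card_lia.
(* The neighbor [K3] of [K1] opposite [b'] keeps [w'] and loses [b'], so its cell is [(a, b')].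
   Cells determine facets, so [K3] is [K2], which misses [w']. *)
have RF := simplex_facet grL K1L cK1' b'K1.
have [K3 K3F eK3] := facet_of_facet grL GL K1F RF.
have w'K3 : w' \in K3.
  have : w' \in K3 :&: K1.
    by rewrite eK3 !inE w'K1 andbT; apply: contraNneq w'F => ->; apply: BF.
  by rewrite inE => /andP[].
have nK3 : K3 != F by apply: contraNneq w'F => <-.
have [a3 [b3 [a3A b3B eK3F]]] := cell K3 K3F nK3.
have b'K3 : b' \notin K3.
  apply/negP=> b'K3; have : b' \in K3 :&: K1 by rewrite inE b'K3.
  by rewrite eK3 !inE eqxx.
have eb3 : b' = b3.
  have : b' \notin K3 :&: F by rewrite inE (negPf b'K3).
  rewrite eK3F !inE BF // andbT negbK => /orP[]/eqP // eb.
  by have := nAB _ _ a3A b'B; rewrite eb eqxx.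
have ea3 : a3 = a.
  apply/eqP/negPn/negP=> a3a.
  have a3K1 : a3 \in K1 :&: F by rewrite eK1 !inE negb_or a3a nAB // AF.
  have : a3 \in K3 :&: K1.
    by rewrite eK3 !inE nAB //=; move: a3K1; rewrite inE => /andP[].
  rewrite inE => /andP[a3K3 _].
  have : a3 \in K3 :&: F by rewrite inE a3K3 AF.
  by rewrite eK3F !inE eqxx.
case/negP: w'K2; rewrite -(cell_inj K3 K2) // eK3F eK2 ea3 eb3 //.
Qed.

Lemma nonsimplicial_many_facets G F : G \in L -> rk G + 2 <= #|G| ->
    F \in facets G -> #|F| = rk G ->
    (forall K, K \in facets G -> #|K| <= rk G) ->
  rk G + 6 <= #|facets G|.
Proof.
move=> GL cG FF cF cK; rewrite leqNgt; apply/negP=> mG.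
have /facetP[FL FG rF] := FF.
have as_facets K : K \in L -> #|K| = (rk K).+1 -> exists A B,
  [/\ A \subset K, B \subset K & [disjoint A & B]] /\ [/\ 2 < #|A|, 2 < #|B|,
    #|K :\: (A :|: B)| + (#|A| + #|B|) = #|K|,
    facets K = [set K :\ u | u in K :\: (A :|: B)] :|:
               [set K :\: [set p.1; p.2] | p in setX A B] &
    #|facets K| = #|K :\: (A :|: B)| + #|A| * #|B|].
  move=> KL cK'; have [A [B [AK BK dAB [cA cB] fK]]] :=
    almost_simplex_facets grL nbL KL cK'.
  exists A, B; split=> //; split=> //; last exact: almost_simplex_card_facets.
  have ABK : A :|: B \subset K by rewrite subUset AK.
  have := cardsU A B; rewrite (disjoint_setI0 dAB) cards0 subn0 => <-.
  by rewrite addnC -(cardsID (A :|: B) K) (setIidPr ABK).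
have [|A [B [[AF BF dAB] [cA cB cUAB fF mF]]]] := as_facets F FL; first by rewrite rF.
have ltF := card_facets_lt grL GL FF.
set U := F :\: (A :|: B) in cUAB fF mF.
(* With part sizes [p], [q] and [u] apexes, [u + p * q < #|facets G| < u + p + q + 6], so
   [p * q <= p + q + 4]; for [p, q >= 3] this leaves [p = q = 3]. *)
have /andP[/eqP cA3 /eqP cB3] : (#|A| == 3) && (#|B| == 3).
  move: cA cB cUAB mF ltF mG; rewrite cF.
  move: (#|A|) (#|B|) (#|U|) (rk G) (#|facets F|) (#|facets G|); clear.
  move=> p q u r mF mG p3 q3 e -> lt1 lt2.
  have : p * q <= p + q + 4 by lia.
  have [[p' ->] [q' ->]] : (exists p', p = p' + 3) /\ (exists q', q = q' + 3).
    by split; [exists (p - 3) | exists (q - 3)]; lia.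
  rewrite mulnDl !mulnDr => pq; have -> : p' = 0 by lia.
  by have -> : q' = 0 by lia.
rewrite cA3 cB3 in cUAB mF; rewrite cF in cUAB.
(* The only facet of [F] avoiding an apex [c] is [F :\ c], so at least [#|facets F| = rk G + 3]
   facets of [G] contain [c]. At least three more avoid [c], giving [rk G + 6] in all. *)
have U0 : U = set0.
  apply/eqP/negPn/negP=> /set0Pn[c cU].
  have cFi : c \in F by move: cU; rewrite inE => /andP[].
  have cGi : c \in G := subsetP (proper_sub FG) _ cFi.
  have avoid : 2 < #|[set K in facets G | c \notin K]|.
    apply: card_facets_avoiding_gt2 => // K KF cnK.
    have : ~~ (G :\ c \subset K).
      apply/negP=> /subset_leq_card; have := cK K KF; have := cardsD1 c G.
      by rewrite cGi add1n; card_lia.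
    by case/subsetPn=> y yG yK; exists y.
  have inF : #|facets F| <= #|[set R in facets F | [set c] \subset R]|.+1.
    rewrite -(cardsID [set R : {set V} | c \in R] (facets F)) addnC -[X in _ <= X]add1n.
    apply: leq_add; last first.
      by apply/subset_leq_card/subsetP=> R; rewrite !inE sub1set.
    rewrite -(cards1 (F :\ c)); apply/subset_leq_card/subsetP=> R.
    case/setDP=> RF; rewrite inE in_set1 => cR.
    have cFc : F :\ c \in facets F.
      by rewrite fF in_setU; apply/orP; left; apply/imsetP; exists c.
    apply/eqP; apply: (eq_facet grL RF cFc).
    by rewrite subsetD1 cR; case/facetP: RF => _ /proper_sub ->.
  have cF1 : [set c] \subset F by rewrite sub1set.
  have lt : #|[set R in facets F | [set c] \subset R]| <
            #|[set K in facets G | [set c] \subset K]|.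
    exact: card_facets_containing.
  have mE : #|[set K in facets G | [set c] \subset K]| +
            #|[set K in facets G | c \notin K]| = #|facets G|.
    rewrite -(cardsID [set K : {set V} | c \in K] (facets G)); congr (_ + _).
      by apply: eq_card => K; rewrite !inE sub1set.
    by apply: eq_card => K; rewrite !inE andbC.
  card_lia.
rewrite U0 cards0 in cUAB mF.
have r6 : rk G = 6 by card_lia.
(* A facet of rank 5 with 5 or 6 vertices is a simplex with 5 facets or a sum of two triangles with
   9. *)
have odd_facet K : K \in facets G -> odd #|facets K|.
  move=> KF; have /facetP[KL KG rK] := KF.
  have := rk_le_card grL KL; have := cK K KF; rewrite r6 => cK6 cKr.
  have rK5 : rk K = 5 by card_lia.
  have [c5|c5] := eqVneq #|K| 5; first by rewrite card_facets_simplex ?c5 ?rK5.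
  move/eqP in c5; have [|A' [B' [_ [cA' cB' cU' _ ->]]]] := as_facets K KL.
    by card_lia.
  have -> : #|A'| = 3 by card_lia.
  have -> : #|B'| = 3 by card_lia.
  by have -> : #|K :\: (A' :|: B')| = 0 by card_lia.
have evG := odd_card_facets grL GL odd_facet.
have m10 : #|facets G| = 10.
  move: evG; have : 10 <= #|facets G| <= 11 by apply/andP; split; card_lia.
  by move: (#|facets G|) => m; do 12!case: m => [|m] //.
apply: (no_ten_facets (F := F) (A := A) (B := B) GL) => //.
- by card_lia.
- by move=> K KF; rewrite -r6 cK.
- apply/eqP; rewrite eqEsubset subUset AF BF /= -setD_eq0 -/U U0 //.
- rewrite fF U0; apply/setP=> K; rewrite inE; apply/orP/idP=> [[/imsetP[x]|//]|];
  last by right.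
  by rewrite inE.
Qed.

Theorem neighborly_many_facets G : G \in L -> rk G + 2 <= #|G| ->
  rk G + 6 <= #|facets G|.
Proof.
have [n] := ubnP (rk G); elim: n G => // n IH G rG GL cG.
have r2 : 2 < rk G.
  have /card_gt1P[x [y [xG yG xy]]] : 1 < #|G| by card_lia.
  have [xyL rxy] := nbL x y; rewrite xy /= in rxy.
  have xyG : [set x; y] \subset G by apply/subsetP=> u; rewrite !inE => /orP[]/eqP->.
  have := rk_subset grL xyL GL xyG; rewrite rxy => r2.
  have : [set x; y] \proper G.
    by rewrite properEcard xyG cards2 xy /=; card_lia.
  by move/(graded_rk grL xyL GL); rewrite rxy.
rewrite leqNgt; apply/negP=> mG.
(* A facet with more vertices would have at least [rk K + 6 = rk G + 5] facets by induction, and [G]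
   has strictly more facets than that. *)
have cK K : K \in facets G -> #|K| <= rk G.
  move=> KF; have /facetP[KL _ rK] := KF; have := card_facets_lt grL GL KF.
  move=> ltK; rewrite leqNgt; apply/negP=> cKr.
  have : rk K + 6 <= #|facets K| by apply: IH => //; card_lia.
  card_lia.
have [/existsP[F /andP[FF /eqP cF]]|/existsPn noF] :=
  boolP [exists F, (F \in facets G) && (#|F| == rk G)].
  by have := nonsimplicial_many_facets GL cG FF cF cK; card_lia.
suff /(simplicial_many_facets grL nbL GL r2 cG) : forall K, K \in facets G ->
  (#|K|).+1 = rk G.
  by card_lia.
move=> K KF; have /facetP[KL _ rK] := KF.
have := noF K; rewrite KF /= => /eqP cKr.
by have := cK K KF; have := rk_le_card grL KL; card_lia.
Qed.

End ManyFacets.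

(** * Passing to the vertices *)

Section Atoms.

Variables (V : finType) (L : {set {set V}}) (rk : {set V} -> nat).
Hypothesis grL : graded_lattice L rk.
Hypothesis atomL : forall S, S \in L -> rk S = 1 -> exists x, S = [set x].
Implicit Types (S G H K R : {set V}) (x y : V).

Lemma rk_atom x : [set x] \in L -> rk [set x] = 1.
Proof.
move=> xL; have x0 : set0 \proper [set x].
  by rewrite proper0; apply/set0Pn; exists x; rewrite inE.
have := graded_rk grL (graded_set0 grL) xL x0; rewrite (graded_rk0 grL).
have [//|rx|->//] := ltngtP (rk [set x]) 1.
have [|H HL /andP[H0 Hx]] := graded_between grL (graded_set0 grL) xL x0.
  by rewrite (graded_rk0 grL).
have := proper_card H0; have := proper_card Hx.
by rewrite cards0 cards1; card_lia.
Qed.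

(** Take a facet [H] of [G] over [S], a facet [R] of [H] and the second facet [K] through [R]. An
    atom in [K] outside [R], given by induction, lies outside [H] and so outside [S]. *)
Lemma atom_in_proper S G : S \in L -> G \in L -> S \proper G ->
  exists x, [/\ [set x] \in L, x \in G & x \notin S].
Proof.
have [n] := ubnP (rk G); elim: n S G => // n IH S G rG SL GL SG.
have [r1|r1] := eqVneq (rk G) 1.
  have [x eG] := atomL GL r1; exists x; rewrite -eG; split=> //;
    first by rewrite eG inE.
  by move: SG; rewrite eG => /properP[_ [y]]; rewrite inE => /eqP->.
have [H HF SH] := exists_facet grL SL GL SG; have /facetP[HL HG rH] := HF.
have H0 : set0 \proper H.
  rewrite proper0; apply: contra_neq r1 => H0.
  by rewrite -rH H0 (graded_rk0 grL).
have [R RF _] := exists_facet grL (graded_set0 grL) HL H0.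
have [K KF KH] := facet_of_facet grL GL HF RF.
have /facetP[KL _ rK] := KF; have /facetP[RL _ rR] := RF.
have RK : R \proper K.
  rewrite properEneq -{2}KH subsetIl andbT; apply/eqP=> eRK.
  by rewrite eRK in rR; card_lia.
have [|x [xL xK xR]] := IH R K _ RL KL RK; first by card_lia.
exists x; split=> //; first by case/facetP: KF => _ /proper_sub/subsetP->.
by apply: contra xR => xS; rewrite -KH inE xK (subsetP SH).
Qed.

(** A generating set of a polytope may contain points that are not vertices; restricting all faces
    to the atoms leaves a lattice in which every element is a vertex. *)
Let T : finType := {x : V | [set x] \in L}.
Let trace S : {set T} := [set t | val t \in S].
Let LT : {set {set T}} := [set trace S | S in L].
(** Since [trace] is injective on [L], the choice finds the unique preimage of a member of [LT]; the
    default [set0] is not reached there. *)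
Let rkT (X : {set T}) : nat := rk (odflt set0 [pick S in L | trace S == X]).

(** If [S] is not inside [G], then [S :&: G] is a proper subface of [S], and [atom_in_proper] finds
    an atom of [S] outside [G]. *)
Let trace_subset S G : S \in L -> G \in L -> (trace S \subset trace G) = (S \subset G).
Proof.
move=> SL GL; apply/idP/idP => [/subsetP SG|/subsetP SG]; last first.
  by apply/subsetP=> t; rewrite !inE; apply: SG.
apply/negPn/negP=> nSG.
have SGL := graded_setI grL SL GL.
have [|x [xL xS]] := atom_in_proper SGL SL.
  by rewrite properE subsetIl subsetI subxx.
rewrite inE xS /=; have := SG (Sub x xL); rewrite !inE => /(_ xS) /= xG.
by rewrite xG.
Qed.

Let trace_inj : {in L &, injective trace}.
Proof.
move=> S G SL GL e; apply/eqP; rewrite eqEsubset -!trace_subset // e.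
by rewrite subxx.
Qed.

Let trace_proper S G : S \in L -> G \in L -> (trace S \proper trace G) = (S \proper G).
Proof. by move=> SL GL; rewrite !properE !trace_subset. Qed.

Let rkT_trace S : S \in L -> rkT (trace S) = rk S.
Proof.
move=> SL; rewrite /rkT; case: pickP => [G /andP[GL /eqP/trace_inj->] //|/(_ S)].
by rewrite SL eqxx.
Qed.

Let LTP X : X \in LT -> exists2 S, S \in L & X = trace S.
Proof. by case/imsetP=> S SL ->; exists S. Qed.

Let trace_in S : S \in L -> trace S \in LT.
Proof. exact: imset_f. Qed.

Let traceI S G : trace (S :&: G) = trace S :&: trace G.
Proof. by apply/setP=> t; rewrite !inE. Qed.

Let trace0 : trace set0 = set0.
Proof. by apply/setP=> t; rewrite !inE. Qed.

Let graded_trace : graded_lattice LT rkT.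
Proof.
split.
- by rewrite -trace0; apply: trace_in; apply: (graded_set0 grL).
- by rewrite -trace0 rkT_trace ?(graded_rk0 grL) ?(graded_set0 grL).
- move=> _ _ /LTP[S SL ->] /LTP[G GL ->]; rewrite -traceI.
  by apply: trace_in; apply: (graded_setI grL).
- move=> _ _ /LTP[S SL ->] /LTP[G GL ->]; rewrite trace_proper // !rkT_trace //.
  exact: (graded_rk grL).
- move=> _ _ /LTP[S SL ->] /LTP[G GL ->]; rewrite trace_proper // !rkT_trace //.
  move=> SG /(graded_between grL SL GL SG)[H HL /andP[SH HG]].
  by exists (trace H); rewrite ?trace_in // !trace_proper // SH.
move=> _ _ /LTP[S SL ->] /LTP[G GL ->]; rewrite trace_proper // !rkT_trace //.
move=> SG rSG; rewrite -(graded_diamond grL SL GL SG rSG).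
rewrite -(card_in_imset (f := trace)); last first.
  by move=> H K; rewrite !inE => /andP[HL _] /andP[KL _]; apply: trace_inj.
apply: eq_card => X; apply/idP/imsetP=> [|[H]].
  rewrite inE => /andP[/LTP[H HL ->]]; rewrite !trace_proper // => SHG.
  by exists H; rewrite // inE HL.
by case/setIdP=> HL /andP[SH HG] ->; rewrite inE trace_in // !trace_proper // SH.
Qed.

(** An edge is prescribed through the vertices it contains, since it may also contain other points
    of [V]. *)
Theorem graded_many_facets :
    (forall x y, [set x] \in L -> [set y] \in L -> x != y -> exists S,
      [/\ S \in L, rk S = 2 & forall z, [set z] \in L -> (z \in S) = (z \in [set x;
        y])]) ->
    setT \in L -> rk setT + 2 <= #|[set x | [set x] \in L]| ->
  rk setT + 6 <= #|facets L rk setT|.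
Proof.
move=> edges TL cT.
have cT' : #|trace setT| = #|[set x | [set x] \in L]|.
  rewrite (_ : trace setT = setT); last by apply/setP=> t; rewrite !inE.
  by rewrite cardsT card_sig cardsE.
have nb : neighborly_lattice LT rkT.
  move=> x y; have [->|xy] := eqVneq x y.
    rewrite setUid; have -> : [set y] = trace [set val y].
      by apply/setP=> t; rewrite !inE.
    by rewrite trace_in ?rkT_trace ?rk_atom //; apply: (valP y).
  have [S [SL rS eS]] := edges _ _ (valP x) (valP y) xy.
  have -> : [set x; y] = trace S.
    by apply/setP=> t; rewrite !inE eS ?inE //; apply: (valP t).
  by rewrite trace_in // rkT_trace.
have := neighborly_many_facets graded_trace nb (trace_in TL).
rewrite rkT_trace // cT' => /(_ cT)/leq_trans; apply.
rewrite -(card_in_imset (f := trace) (D := facets L rk setT)); last first.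
  by move=> H K /facetP[HL _ _] /facetP[KL _ _]; apply: trace_inj.
apply/subset_leq_card/subsetP=> X /facetP[/LTP[H HL ->]].
rewrite trace_proper // !rkT_trace // => HT rH.
by apply: imset_f; apply/facetP.
Qed.

End Atoms.

(** * Face lattices of polytopes *)

Import Order.TTheory GRing.Theory Num.Theory.
Local Open Scope ring_scope.

Section VectorConfiguration.

Variables (R : realFieldType) (N : nat) (V : finType) (h : V -> 'rV[R]_N).
Implicit Types (S G H : {set V}) (i j : V) (c e f : 'cV[R]_N).

Definition pairing c i : R := (h i *m c) 0 0.

Definition config_span S : 'M[R]_N := (\sum_(i in S) <<h i>>)%MS.

Definition config_rk S : nat := \rank (config_span S).

(** These are the faces of the cone generated by the vectors [h i], each recorded by the generators
    on it; [c] is a supporting functional. *)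
Definition config_faces : {set {set V}} :=
  [set S : {set V} | `[< exists c, forall i,
     0 <= pairing c i /\ (i \in S) = (pairing c i == 0) >]].

Lemma config_faceP S : reflect (exists c, forall i,
  0 <= pairing c i /\ (i \in S) = (pairing c i == 0)) (S \in config_faces).
Proof. by rewrite inE; apply: asboolP. Qed.

Lemma pairingD c e i : pairing (c + e) i = pairing c i + pairing e i.
Proof. by rewrite /pairing mulmxDr mxE. Qed.

Lemma pairingZ t c i : pairing (t *: c) i = t * pairing c i.
Proof. by rewrite /pairing -scalemxAr mxE. Qed.

Lemma pairingN c i : pairing (- c) i = - pairing c i.
Proof. by rewrite /pairing mulmxN mxE. Qed.

Lemma config_span_sub S k (A : 'M_(k, N)) :
  reflect (forall i, i \in S -> (h i <= A)%MS) (config_span S <= A)%MS.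
Proof.
apply: (iffP sumsmx_subP) => hA i iS; first by rewrite -genmxE hA.
by rewrite genmxE hA.
Qed.

Lemma sub_config_span S i : i \in S -> (h i <= config_span S)%MS.
Proof. by move: i; apply/config_span_sub. Qed.

Lemma ann_config_span S c :
  reflect (forall i, i \in S -> pairing c i = 0) (c^T <= kermx (config_span S)^T)%MS.
Proof.
rewrite sub_kermx -trmx_mul trmx_eq0 -sub_kermx.
apply: (iffP (config_span_sub _ _)) => hc i iS.
  by have := hc i iS; rewrite sub_kermx /pairing => /eqP->; rewrite mxE.
by rewrite sub_kermx; apply/eqP/matrixP=> x y; rewrite !ord1 [RHS]mxE; apply: hc.
Qed.

Lemma rank_ann S : \rank (kermx (config_span S)^T) = (N - config_rk S)%N.
Proof. by rewrite mxrank_ker mxrank_tr. Qed.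

(** Adding a large multiple of the functional defining [G] leaves [f] unchanged on [G] and makes it
    positive outside. *)
Lemma face_of_face G f : G \in config_faces ->
  (forall i, i \in G -> 0 <= pairing f i) ->
  [set i in G | pairing f i == 0] \in config_faces.
Proof.
move=> /config_faceP[g gP] fG; apply/config_faceP.
(* [K] exceeds every ratio of [|f|] to [g]; the terms with [pairing g j = 0] vanish because division
   by zero gives zero. *)
pose K : R := 1 + \sum_j `|pairing f j| / pairing g j.
have Kge i : pairing g i != 0 -> - pairing f i < K * pairing g i.
  move=> gi; have g0 : 0 < pairing g i by rewrite lt_def gi (gP i).1.
  apply: le_lt_trans (ler_norm _) _; rewrite normrN -ltr_pdivrMr // /K.
  rewrite (bigD1 i) //= addrCA ltrDl ltr_pwDl // sumr_ge0 // => j _.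
  by rewrite divr_ge0 ?normr_ge0 ?(gP j).1.
exists (f + K *: g) => i; rewrite inE pairingD pairingZ.
have [g0 giG] := gP i; rewrite giG.
have [gi0|gi] := eqVneq (pairing g i) 0.
  by rewrite gi0 mulr0 addr0; split=> //; apply: fG; rewrite giG gi0.
have := Kge i gi; rewrite -subr_gt0 opprK addrC => pos.
by rewrite ltW //= gt_eqF.
Qed.

Lemma config_facesI S G : S \in config_faces -> G \in config_faces ->
  S :&: G \in config_faces.
Proof.
move=> SL GL; move: (SL) => /config_faceP[c cP].
have -> : S :&: G = [set i in G | pairing c i == 0].
  by apply/setP=> i; rewrite !inE (cP i).2 andbC.
by apply: face_of_face => // i _; exact: (cP i).1.
Qed.

(** The functional defining [S] vanishes on the span of [S] but not at a vector of [G] outside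
    [S]. *)
Lemma config_rk_lt S G : S \in config_faces -> S \proper G ->
  (config_rk S < config_rk G)%N.
Proof.
move=> /config_faceP[c cP] /properP[/subsetP SG [i iG iS]].
have sSG : (config_span S <= config_span G)%MS.
  by apply/config_span_sub => j /SG; apply: sub_config_span.
have : (config_span S < config_span G)%MS.
  rewrite ltmxE sSG /=; apply/negP=> sGS.
  have /ann_config_span cS : forall j, j \in S -> pairing c j = 0.
    by move=> j; rewrite (cP j).2 => /eqP.
  have : (c^T <= kermx (config_span G)^T)%MS.
    move: cS; rewrite !sub_kermx -!trmx_mul !trmx_eq0 -!sub_kermx.
    exact: submx_trans.
  by move/ann_config_span/(_ i iG)/eqP; rewrite -(cP i).2 (negPf iS).
by rewrite ltmxErank => /andP[].
Qed.

(* A functional e vanishing on S, independent of c modulo the functionals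
   vanishing on G: tilting c along e produces the faces between S and G. *)
Lemma tilting_functional S G c : S \subset G ->
    (forall i, i \in S -> pairing c i = 0) ->
    (config_rk S + 1 < config_rk G)%N ->
  exists e, (e^T <= kermx (config_span S)^T)%MS /\
            ~~ (e^T <= c^T + kermx (config_span G)^T)%MS.
Proof.
move=> SG cS rSG.
have : ~~ (kermx (config_span S)^T <= c^T + kermx (config_span G)^T)%MS.
  apply/negP=> /mxrankS; rewrite rank_ann leqNgt => /negP; apply.
  apply: leq_ltn_trans (mxrank_adds_leqif _ _) _; rewrite rank_ann.
  have := rank_leq_row c^T; have := rank_leq_row (config_span G).
  by move: rSG; rewrite /config_rk; lia.
case/row_subPn=> i ni; exists (row i (kermx (config_span S)^T))^T.
by rewrite trmxK row_sub.
Qed.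

(** On [G :\: S] consider the ratio [rho] of [e] to [c]. Its maximal and minimal level sets, joined
    to [S], are two faces strictly between. In corank two every functional vanishing on [S] is a
    combination of [e] and [c] on [G], so no other face occurs. *)
Lemma tilted_faces S G : S \in config_faces -> G \in config_faces ->
    S \proper G -> (config_rk S + 1 < config_rk G)%N ->
  exists H1 H2, [/\ (H1 \in config_faces) && (H2 \in config_faces), H1 != H2,
    (S \proper H1) && (H1 \proper G), (S \proper H2) && (H2 \proper G) &
    config_rk G = (config_rk S + 2)%N -> forall H, H \in config_faces ->
      (S \proper H) && (H \proper G) -> H = H1 \/ H = H2].
Proof.
move=> SL GL SpG rSG; have /config_faceP[c cP] := SL.
have SG := proper_sub SpG.
have cS i : i \in S -> pairing c i = 0 by rewrite (cP i).2 => /eqP.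
have c_gt0 i : i \notin S -> 0 < pairing c i.
  by move=> iS; rewrite lt_def (cP i).1 -(cP i).2 iS.
have [e [/[dup] eK /ann_config_span eS] neG] := tilting_functional SG cS rSG.
pose rho i := pairing e i / pairing c i.
have rhoE i : i \notin S -> pairing e i = rho i * pairing c i.
  by move=> iS; rewrite /rho divfK // gt_eqF // c_gt0.
(* A constant ratio [t] would make [e - t *: c] vanish on [G], against the independence of [e]. *)
have nonconst t : exists2 i, i \in G :\: S & rho i != t.
  apply/exists_inP; apply: contraNT neG => /exists_inPn allt.
  rewrite -(subrK (t *: c) e) linearD /= addrC addmx_sub_adds //.
    by rewrite linearZ /= scalemx_sub.
  apply/ann_config_span=> i iG; rewrite pairingD pairingN pairingZ.
  have [iS|iS] := boolP (i \in S); first by rewrite eS // cS // mulr0 subrr.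
  have := allt i; rewrite inE iS iG negbK => /(_ isT)/eqP rt.
  by rewrite rhoE // rt subrr.
have [i0 i0D _] := nonconst 0.
case: (@arg_maxP _ _ _ i0 (mem (G :\: S)) rho i0D) => iM iMD maxM.
case: (@arg_minP _ _ _ i0 (mem (G :\: S)) rho i0D) => im imD minm.
have {}maxM i : i \in G :\: S -> rho i <= rho iM by apply: maxM.
have {}minm i : i \in G :\: S -> rho im <= rho i by apply: minm.
have {}iMD : iM \in G :\: S by [].
have {}imD : im \in G :\: S by [].
pose lev t := S :|: [set i in G :\: S | rho i == t].
have lev_proper j : j \in G :\: S -> (S \proper lev (rho j)) && (lev (rho j) \proper G).
  move=> jD; apply/andP; split.
    apply/properP; split; first exact: subsetUl.
    by exists j; [rewrite in_setU inE jD eqxx orbT | move: jD; rewrite inE => /andP[]].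
  apply/properP; split.
    by rewrite subUset SG; apply/subsetP=> k; rewrite !inE => /andP[/andP[]].
  have [k kD kj] := nonconst (rho j); exists k; first by move: kD;
    rewrite inE => /andP[].
  by rewrite in_setU negb_or inE kD kj andbT; move: kD; rewrite inE => /andP[].
have faceM : lev (rho iM) \in config_faces.
  have -> : lev (rho iM) = [set i in G | pairing (rho iM *: c - e) i == 0].
    apply/setP=> i; rewrite !inE pairingD pairingN pairingZ.
    have [iS|iS] := boolP (i \in S);
      first by rewrite cS // eS // mulr0 subrr eqxx (subsetP SG).
    by rewrite rhoE // -mulrBl mulf_eq0 (gt_eqF (c_gt0 _ iS)) orbF subr_eq0 eq_sym.
  apply: face_of_face => // i iG; rewrite pairingD pairingN pairingZ.
  have [iS|iS] := boolP (i \in S); first by rewrite cS // eS // mulr0 subrr.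
  rewrite rhoE // -mulrBl mulr_ge0 ?(cP i).1 // subr_ge0.
  by apply: maxM; rewrite inE iS.
have facem : lev (rho im) \in config_faces.
  have -> : lev (rho im) = [set i in G | pairing (e - rho im *: c) i == 0].
    apply/setP=> i; rewrite !inE pairingD pairingN pairingZ.
    have [iS|iS] := boolP (i \in S);
      first by rewrite cS // eS // mulr0 subrr eqxx (subsetP SG).
    by rewrite rhoE // -mulrBl mulf_eq0 (gt_eqF (c_gt0 _ iS)) orbF subr_eq0.
  apply: face_of_face => // i iG; rewrite pairingD pairingN pairingZ.
  have [iS|iS] := boolP (i \in S); first by rewrite cS // eS // mulr0 subrr.
  rewrite rhoE // -mulrBl mulr_ge0 ?(cP i).1 // subr_ge0.
  by apply: minm; rewrite inE iS.
exists (lev (rho iM)), (lev (rho im)); split; try exact: lev_proper.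
  by rewrite faceM.
  have [k kD kM] := nonconst (rho iM).
  apply: contraNneq kM => /setP/(_ im); rewrite in_setU [im \in lev _]in_setU.
  have /setDP[_ /negPf->] := imD; rewrite !inE eqxx /= andbT.
  move: (imD); rewrite inE => -> /= /eqP emM.
  by rewrite eq_le; apply/andP; split; [apply: maxM | rewrite -emM; apply: minm].
move=> rG H HL /andP[SH HG]; have /config_faceP[f fP] := HL.
have SHs := subsetP (proper_sub SH).
have fS : (f^T <= kermx (config_span S)^T)%MS.
  by apply/ann_config_span=> i /SHs; rewrite (fP i).2 => /eqP.
set KG := kermx (config_span G)^T in neG *.
have cG : ~~ (c^T <= KG)%MS.
  apply/negP=> /ann_config_span/(_ iM); have /setDP[iMG iMS] := iMD.
  by move=> /(_ iMG)/eqP; rewrite gt_eqF // c_gt0.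
have KGS : (KG <= kermx (config_span S)^T)%MS.
  apply/row_subP=> k; rewrite -[row k KG]trmxK; apply/ann_config_span=> i iS.
  have : (((row k KG)^T)^T <= KG)%MS by rewrite trmxK row_sub.
  by move/ann_config_span/(_ i); rewrite (subsetP SG) //; apply.
have r1 : (\rank KG < \rank (c^T + KG)%MS)%N.
  have : (KG < c^T + KG)%MS.
    by rewrite ltmxE addsmxSr addsmx_sub submx_refl andbT.
  by rewrite ltmxErank => /andP[].
have r2 : (\rank (c^T + KG)%MS < \rank (e^T + (c^T + KG))%MS)%N.
  have : (c^T + KG < e^T + (c^T + KG))%MS.
    by rewrite ltmxE addsmxSr addsmx_sub submx_refl andbT.
  by rewrite ltmxErank => /andP[].
have sub : (e^T + (c^T + KG) <= kermx (config_span S)^T)%MS.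
  rewrite !addsmx_sub eK KGS andbT /=.
  by apply/ann_config_span.
(* The annihilator of [S] has rank two more than [KG], and adjoining [c] and then [e] raises the
   rank each time, so the sum is the whole annihilator. *)
have : (f^T <= e^T + (c^T + KG))%MS.
  apply: submx_trans fS _; rewrite -(geq_leqif (mxrank_leqif_sup sub)).
  have rGN : (config_rk G <= N)%N := rank_leq_row _.
  move: r1 r2 rGN; rewrite {1}rank_ann rank_ann rG.
  by move: (\rank (c^T + _)) (\rank (e^T + _)) (config_rk S); clear; lia.
case/sub_addsmxP=> -[a x] /= fE.
have : (x *m (c^T + KG)%MS <= c^T + KG)%MS by rewrite submxMl.
case/sub_addsmxP=> -[b y] /= xE; rewrite xE in fE.
have fG i : i \in G -> pairing f i = a 0 0 * pairing e i + b 0 0 * pairing c i.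
  move=> iG; rewrite -(trmxK f) fE !linearD /= !pairingD addrA.
  have -> : pairing (y *m KG)^T i = 0.
    have : (((y *m KG)^T)^T <= KG)%MS by rewrite trmxK submxMl.
    by move/ann_config_span/(_ i iG).
  rewrite addr0 [a]mx11_scalar [b]mx11_scalar !mul_scalar_mx !linearZ /= !trmxK.
  by rewrite !pairingZ !mxE !eqxx !mulr1n.
have fD i : i \in G :\: S -> pairing f i = (a 0 0 * rho i + b 0 0) * pairing c i.
  by case/setDP=> iG iS; rewrite fG // rhoE // mulrDl mulrA.
have cD i : i \in G :\: S -> 0 < pairing c i by case/setDP=> _; apply: c_gt0.
have HD i : i \in G :\: S -> (i \in H) = (a 0 0 * rho i + b 0 0 == 0).
  by move=> iD; rewrite (fP i).2 fD // mulf_eq0 (gt_eqF (cD i iD)) orbF.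
have ge0D i : i \in G :\: S -> 0 <= a 0 0 * rho i + b 0 0.
  by move=> iD; have := (fP i).1; rewrite fD // pmulr_lge0 // cD.
have /properP[_ [j jH jS]] := SH; have /properP[HsG [k kG kH]] := HG.
have jD : j \in G :\: S by rewrite inE jS (subsetP HsG).
have kD : k \in G :\: S by rewrite inE kG andbT; apply: contra kH; apply: SHs.
have /eqP j0 : a 0 0 * rho j + b 0 0 == 0 by rewrite -HD.
have a0 : a 0 0 != 0.
  apply: contraNneq kH => a0; rewrite HD //; move/eqP: j0.
  by rewrite a0 !mul0r.
have H_lev : H = lev (rho j).
  apply/setP=> i; rewrite in_setU inE.
  have [iS|iS] /= := boolP (i \in S); first exact: SHs.
  have [iG|iG] := boolP (i \in G); last first.
    by rewrite inE (negPf iG) andbF; apply/negP=> /(subsetP HsG); rewrite (negPf iG).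
  have iD : i \in G :\: S by rewrite inE iS.
  rewrite iD HD // -j0 (inj_eq (addIr _)) (inj_eq (mulfI a0)) //.
have ge i : i \in G :\: S -> a 0 0 * rho j <= a 0 0 * rho i.
  by move=> iD; rewrite -(lerD2r (b 0 0)) j0 ge0D.
(* The expression [a * rho + b] is nonnegative on [G :\: S] and zero at [j], so the sign of [a]
   decides whether [rho j] is the minimum or the maximum. *)
have [ap|an|az] := ltgtP 0 (a 0 0).
- right; rewrite H_lev; congr lev; apply/eqP; rewrite eq_le minm // andbT.
  by have := ge im imD; rewrite ler_pM2l.
- left; rewrite H_lev; congr lev; apply/eqP; rewrite eq_le maxM //=.
  by have := ge iM iMD; rewrite ler_nM2l.
- by rewrite -az eqxx in a0.
Qed.

(** The positive functional says that the cone is pointed; it makes the empty set a face. *)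
Lemma config_graded : (exists c, forall i, 0 < pairing c i) ->
  graded_lattice config_faces config_rk.
Proof.
move=> [c c_gt0]; split.
- apply/config_faceP; exists c => i; split; first exact: ltW.
  by rewrite inE gt_eqF.
- by rewrite /config_rk /config_span big_set0 mxrank0.
- exact: config_facesI.
- by move=> S G SL _; apply: config_rk_lt.
- move=> S G SL GL SG; rewrite -addn1 => rSG.
  have [H1 [_ [/andP[H1L _] _ H1P _ _]]] := tilted_faces SL GL SG rSG.
  by exists H1.
move=> S G SL GL SG rG.
have rSG : (config_rk S + 1 < config_rk G)%N by rewrite rG; lia.
have [H1 [H2 [/andP[H1L H2L] H12 P1 P2 only]]] := tilted_faces SL GL SG rSG.
have {}only := only _; rewrite rG addn2 in only.
have -> : [set H in config_faces | (S \proper H) && (H \proper G)] = [set H1; H2].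
  by apply/setP=> H; apply/setIdP/set2P => [[HL]|[]->] //; apply: only.
by rewrite cards2 H12.
Qed.

Lemma config_setT : setT \in config_faces.
Proof.
apply/config_faceP; exists 0 => i.
by rewrite /pairing mulmx0 mxE eqxx inE lexx.
Qed.

(** Vectors spanning a line together are proportional, which the second hypothesis excludes for
    distinct indices. *)
Lemma config_atom S : (forall i, h i != 0) ->
    (forall i j, (h i <= h j)%MS -> i = j) -> config_rk S = 1 ->
  exists i, S = [set i].
Proof.
move=> h0 h_inj rS; have [S0|/set0Pn[i iS]] := eqVneq S set0.
  by move: rS; rewrite S0 /config_rk /config_span big_set0 mxrank0.
exists i; apply/setP=> j; rewrite inE; apply/idP/eqP => [jS|->//].
apply: h_inj; apply: submx_trans (sub_config_span jS) _.
rewrite -(geq_leqif (mxrank_leqif_sup (sub_config_span iS))).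
by rewrite -/(config_rk S) rS lt0n mxrank_eq0.
Qed.

End VectorConfiguration.

(** * Convex hulls, affine hulls and supporting hyperplanes *)

Section Hulls.

Variables (R : realType) (n : nat).
Implicit Types (A B : set 'rV[R]_n) (x y p u : 'rV[R]_n) (t : R).

Lemma convex_setP A : @convex_set R 'rV[R]_n A <->
  forall x y t, 0 <= t -> t <= 1 -> A x -> A y -> A (t *: x + (1 - t) *: y).
Proof.
split=> [cA x y t t0 t1 Ax Ay|cA x y t].
  by have := cA x y (Itv01 t0 t1); rewrite !in_setE => /(_ Ax Ay).
by rewrite !in_setE => Ax Ay; apply: cA.
Qed.

Lemma convex_hull_convex A : @convex_set R 'rV[R]_n (convex_hull A).
Proof.
apply/convex_setP => x y t t0 t1 Ax Ay C [cC AC].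
move/convex_setP: (cC); apply=> //; [exact: Ax | exact: Ay].
Qed.

Lemma sub_convex_hull A x : A x -> convex_hull A x.
Proof. by move=> Ax C [_]; apply. Qed.

Lemma convex_hull_min A B : @convex_set R 'rV[R]_n B ->
  (forall x, A x -> B x) -> forall x, convex_hull A x -> B x.
Proof. by move=> cB AB x Ax; apply: (Ax B). Qed.

Lemma affine_hull_affine A : affine_set (affine_hull A).
Proof. by move=> x y t Ax Ay C CP; apply: (proj1 CP); [apply: Ax | apply: Ay]. Qed.

Lemma sub_affine_hull A x : A x -> affine_hull A x.
Proof. by move=> Ax C [_]; apply. Qed.

Lemma affine_hull_min A B : affine_set B ->
  (forall x, A x -> B x) -> forall x, affine_hull A x -> B x.
Proof. by move=> cB AB x Ax; apply: (Ax B). Qed.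

Lemma affine_convex A : affine_set A -> @convex_set R 'rV[R]_n A.
Proof. by move=> aA; apply/convex_setP => x y t _ _; apply: aA. Qed.

Lemma affine_scale A p u t : affine_set A -> A p -> A (p + u) -> A (p + t *: u).
Proof.
move=> aA Ap Au; have := aA _ _ t Au Ap.
by rewrite scalerDr addrAC -scalerDl subrKC scale1r.
Qed.

(** The midpoint of [p + u] and [p + v] is stretched from [p] by the factor 2. *)
Lemma affine_add A p u v : affine_set A -> A p -> A (p + u) -> A (p + v) ->
  A (p + (u + v)).
Proof.
move=> aA Ap Au Av; have := aA _ _ (2^-1) Au Av.
have -> : 2^-1 *: (p + u) + (1 - 2^-1) *: (p + v) = p + 2^-1 *: (u + v).
  have -> : 1 - 2^-1 = 2^-1 :> R by rewrite {1}[1]splitr mul1r addrK.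
  by rewrite -scalerDr addrACA scalerDr -mulr2n -scaler_nat scalerA mulVf ?scale1r
    ?pnatr_eq0.
by move=> /(affine_scale 2 aA Ap); rewrite scalerA mulfV ?scale1r.
Qed.

Lemma translate_affine p (U : {vspace 'rV[R]_n}) :
  affine_set [set p + u | u in [set` U]]%classic.
Proof.
move=> _ _ t [u Uu <-] [v Uv <-]; exists (t *: u + (1 - t) *: v) => /=.
  by rewrite memvD ?memvZ.
by rewrite !scalerDr addrACA -scalerDl subrKC scale1r.
Qed.

Lemma translate_eq p q (U W : {vspace 'rV[R]_n}) :
  [set p + u | u in [set` U]]%classic = [set q + u | u in [set` W]]%classic -> U = W.
Proof.
move=> e.
have [w Ww pw] : [set q + u | u in [set` W]]%classic p.
  by rewrite -e; exists 0; rewrite ?addr0 //= mem0v.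
apply/vspaceP=> u; apply/idP/idP => hu.
  have [v Wv uv] : [set q + u | u in [set` W]]%classic (p + u) by rewrite -e; exists u.
  have -> : u = v - w by rewrite -(addrK p u) [u + p]addrC -uv -pw opprD addrA [q +
    v]addrC addrK.
  by rewrite memvB.
have [v Uv uv] : [set p + u | u in [set` U]]%classic (p + u).
  rewrite e; exists (w + u); last by rewrite addrA pw.
  by rewrite /= memvD.
by have <- : v = u by apply: (addrI p).
Qed.

Lemma dotvE x y : dotv x y = (y *m x^T) 0 0.
Proof. by rewrite /dotv mxE; apply: eq_bigr => i _; rewrite mxE mulrC. Qed.

Lemma dotvDr c x y : dotv c (x + y) = dotv c x + dotv c y.
Proof. by rewrite !dotvE mulmxDl mxE. Qed.

Lemma dotvZr c t x : dotv c (t *: x) = t * dotv c x.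
Proof. by rewrite !dotvE -scalemxAl mxE. Qed.

Lemma dotv_comb c t x y b : dotv c x = b -> dotv c y = b ->
  dotv c (t *: x + (1 - t) *: y) = b.
Proof. by move=> xb yb; rewrite dotvDr !dotvZr xb yb -mulrDl subrKC mul1r. Qed.

Lemma halfspace_convex c b : @convex_set R 'rV[R]_n [set x | dotv c x <= b]%classic.
Proof.
apply/convex_setP => x y t t0 t1 /= xb yb; rewrite dotvDr !dotvZr.
have -> : b = t * b + (1 - t) * b by rewrite -mulrDl subrKC mul1r.
by rewrite lerD // ler_wpM2l // subr_ge0.
Qed.

Lemma convex_hull_supporting A B c b :
    (forall x, A x -> dotv c x <= b) -> (forall x, A x -> dotv c x = b -> B x) ->
  forall x, convex_hull A x -> dotv c x = b -> convex_hull B x.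
Proof.
move=> Ab AB x Ax xb.
(* The points satisfying the claim form a convex set, which avoids explicit
   convex combinations. *)
pose Q := [set y | dotv c y <= b /\ (dotv c y = b -> convex_hull B y)]%classic.
suff cQ : @convex_set R 'rV[R]_n Q.
  have [_] : Q x; last exact.
  apply: convex_hull_min Ax => // y Ay; split; first exact: Ab.
  by move=> yb; apply: sub_convex_hull; apply: AB.
apply/convex_setP => y z t t0 t1 [yb yB] [zb zB]; split.
  exact: ((convex_setP _).1 (@halfspace_convex c b) y z t t0 t1 yb zb).
have [->|tn0] := eqVneq t 0; first by rewrite scale0r add0r subr0 scale1r.
have [->|tn1] := eqVneq t 1; first by rewrite subrr scale0r addr0 scale1r.
have {}t0 : 0 < t by rewrite lt_def tn0.
have {}t1 : 0 < 1 - t by rewrite subr_gt0 lt_def eq_sym tn1.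
rewrite dotvDr !dotvZr => tb.
have tb' : t * (b - dotv c y) + (1 - t) * (b - dotv c z) = 0.
  by rewrite !mulrBr addrACA -opprD tb -mulrDl subrKC mul1r subrr.
have y0 : 0 <= t * (b - dotv c y) by rewrite pmulr_rge0 // subr_ge0.
have z0 : 0 <= (1 - t) * (b - dotv c z) by rewrite pmulr_rge0 // subr_ge0.
move/eqP: tb'; rewrite paddr_eq0 // => /andP[yz1 zz1].
have yb' : dotv c y = b.
  by move: yz1; rewrite mulf_eq0 (gt_eqF t0) subr_eq0 => /eqP.
have zb' : dotv c z = b.
  by move: zz1; rewrite mulf_eq0 (gt_eqF t1) subr_eq0 => /eqP.
apply: ((convex_setP _).1 (@convex_hull_convex B)).
- exact: ltW.
- by rewrite -subr_ge0 ltW.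
- exact: yB.
- exact: zB.
Qed.

End Hulls.

(** * Faces of a polytope as faces of the lifted configuration *)

Section PointConfiguration.

Variables (R : realType) (n : nat) (V : finType) (p : V -> 'rV[R]_n).
Hypothesis p_inj : injective p.
Implicit Types (S G H : {set V}) (i j : V) (x y u : 'rV[R]_n).

(** Homogenization: height one turns affine inequalities on points into linear ones on vectors, and
    affine dimension into rank minus one. *)
Definition lift_point i : 'rV[R]_(1 + n) := row_mx 1%:M (p i).

Local Notation h := lift_point.
Local Notation L := (config_faces h).
Local Notation rk := (config_rk h).

Definition hull S : set 'rV[R]_n :=
  convex_hull [set x | exists2 i, i \in S & x = p i]%classic.

Lemma mem_hull S i : i \in S -> hull S (p i).
Proof. by move=> iS; apply: sub_convex_hull; exists i. Qed.

Lemma hullS S G : S \subset G -> forall x, hull S x -> hull G x.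
Proof.
move=> /subsetP SG; apply: convex_hull_min; first exact: convex_hull_convex.
by move=> x [i /SG iG ->]; apply: mem_hull.
Qed.

Lemma pairing_lift (c : 'cV[R]_(1 + n)) i :
  pairing h c i = c 0 0 - dotv (- (dsubmx c)^T) (p i).
Proof.
rewrite /pairing /lift_point -[c in LHS]vsubmxK mul_row_col mul1mx mxE dotvE.
rewrite raddfN /= trmxK mulmxN [X in _ - X]mxE opprK; congr (_ + _).
by rewrite mxE; congr (c _ _); apply/val_inj.
Qed.

Lemma pairing_col b (c : 'rV[R]_n) i :
  pairing h (col_mx b%:M (- c^T)) i = b - dotv c (p i).
Proof.
by rewrite /pairing mul_row_col mul1mx mulmxN dotvE !mxE eqxx mulr1n.
Qed.

(** A functional nonnegative on the lifts is a valid inequality for the points, tight exactly on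
    [S]. The second part recovers [S] from its hull, which makes [hull] injective on [L]. *)
Lemma hull_face S : S \in L -> face (hull setT) (hull S) /\
  (forall i, hull S (p i) -> i \in S).
Proof.
move=> /config_faceP[a aP]; set c := - (dsubmx a)^T; set b := a 0 0.
have pb i : dotv c (p i) <= b.
  by have := (aP i).1; rewrite pairing_lift subr_ge0.
have iS i : (i \in S) = (dotv c (p i) == b).
  by rewrite (aP i).2 pairing_lift subr_eq0 eq_sym.
have Sb x : hull S x -> dotv c x = b.
  apply: (@convex_hull_min _ _ _ [set x | dotv c x = b]%classic); last first.
    by move=> _ [i + ->]; rewrite iS => /eqP.
  by apply/convex_setP => y z t _ _; apply: dotv_comb.
split; last by move=> i /Sb /eqP; rewrite -iS.
exists c, b; split.
  apply: (@convex_hull_min _ _ _ [set x | dotv c x <= b]%classic).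
    exact: halfspace_convex.
  by move=> _ [i _ ->]; apply: pb.
apply/seteqP; split=> x /=.
  by move=> Sx; split; [apply: hullS Sx; apply: subsetT | apply: Sb].
case=> Tx xb; apply: convex_hull_supporting Tx xb.
  by move=> _ [i _ ->]; apply: pb.
by move=> _ [i _ ->] /eqP; rewrite -iS => iS'; exists i.
Qed.

Lemma face_hull F : face (hull setT) F -> exists2 S, S \in L & F = hull S.
Proof.
move=> [c [b [cb ->]]]; exists [set i | dotv c (p i) == b].
  apply/config_faceP; exists (col_mx b%:M (- c^T)) => i.
  rewrite pairing_col inE subr_eq0 [b == _]eq_sym subr_ge0.
  by split=> //; apply: cb; apply: mem_hull.
apply/seteqP; split=> x /=.
  case=> Tx xb; apply: convex_hull_supporting Tx xb.
    by move=> _ [i _ ->]; apply: cb; apply: mem_hull.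
  by move=> _ [i _ ->] ib; exists i; rewrite ?inE ?ib.
move=> Sx; split; first by apply: hullS Sx; apply: subsetT.
move: Sx; apply: (@convex_hull_min _ _ _ [set x | dotv c x = b]%classic).
  by apply/convex_setP => y z t _ _; apply: dotv_comb.
by move=> _ [i + ->]; rewrite inE => /eqP.
Qed.

Lemma lift_neq0 i : h i != 0.
Proof.
apply/eqP=> /rowP/(_ (lshift n 0)); rewrite row_mxEl !mxE eqxx /= => /eqP.
by rewrite oner_eq0.
Qed.

Lemma lift_inj i j : (h i <= h j)%MS -> i = j.
Proof.
case/sub_rVP=> a; rewrite scale_row_mx => /eq_row_mx[/matrixP/(_ 0 0)].
by rewrite !mxE eqxx mulr1 => <-; rewrite scale1r => /p_inj.
Qed.

Lemma lift_graded : graded_lattice L rk.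
Proof.
apply: config_graded; exists (col_mx 1%:M 0) => i.
by rewrite /pairing mul_row_col mul1mx mulmx0 addr0 mxE eqxx ltr01.
Qed.

Lemma hull_inj : {in L &, injective hull}.
Proof.
move=> S G SL GL e; apply/setP=> i; apply/idP/idP => [iS|iG].
  by apply: (hull_face GL).2; rewrite -e; apply: mem_hull.
by apply: (hull_face SL).2; rewrite e; apply: mem_hull.
Qed.

Definition directions S i : {vspace 'rV[R]_n} := (\sum_(j in S) <[p j - p i]>)%VS.

Lemma direction_mem S i j : j \in S -> p j - p i \in directions S i.
Proof. by move=> jS; rewrite memvE; apply: (sumv_sup j). Qed.

Lemma directionsP S i u : u \in directions S i ->
  exists a : V -> R, u = \sum_(j in S) a j *: (p j - p i).
Proof.
case/memv_sumP=> v vP ->.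
have vE j : exists a, j \in S -> v j = a *: (p j - p i).
  have [/vP/vlineP[a va]|_] := boolP (j \in S); first by exists a.
  by exists 0.
have [a aE] := choice vE; exists a.
by apply: eq_bigr => j jS; apply: aE.
Qed.

Lemma affine_hull_hull S i : i \in S ->
  affine_hull (hull S) = [set p i + u | u in [set` directions S i]]%classic.
Proof.
move=> iS; apply/seteqP; split.
  move=> x; apply: affine_hull_min; first exact: translate_affine.
  apply: convex_hull_min; first by apply: affine_convex; apply: translate_affine.
  move=> _ [j jS ->]; exists (p j - p i); last by rewrite subrKC.
  exact: direction_mem.
move=> _ [u /= /directionsP[a ->] <-].
have aff : affine_set (affine_hull (hull S)) by apply: affine_hull_affine.
have Ap : affine_hull (hull S) (p i) by apply: sub_affine_hull; apply: mem_hull.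
apply: (big_ind (fun v => affine_hull (hull S) (p i + v))).
- by rewrite addr0.
- by move=> v w; apply: (affine_add aff Ap).
move=> j jS; apply: (affine_scale _ aff Ap); rewrite subrKC.
by apply: sub_affine_hull; apply: mem_hull.
Qed.

(** The span of the lifts is generated by the lift of [p i] and the vectors [row_mx 0 u] with [u] a
    direction; the block matrix [C] lists such a basis. *)
Lemma config_rk_directions S i : i \in S -> rk S = (\dim (directions S i)).+1.
Proof.
move=> iS; set U := directions S i.
pose B : 'M[R]_(\dim U, n) := \matrix_(k, l) (vbasis U)`_k 0 l.
have rowB k : row k B = (vbasis U)`_k by apply/rowP=> l; rewrite !mxE.
pose C : 'M[R]_(1 + \dim U, 1 + n) := block_mx 1%:M (p i) 0 B.
have mulC (a : 'M_1) (w : 'rV_(\dim U)) :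
    row_mx a w *m C = row_mx a (a *m p i + w *m B).
  by rewrite mul_row_block mulmx1 mulmx0 addr0.
have freeC : row_free C.
  apply: inj_row_free => v; rewrite -[v]hsubmxK mulC -[0 in X in X -> _]row_mx0.
  case/eq_row_mx=> -> ; rewrite mul0mx add0r => wB.
  suff -> : rsubmx v = 0 by rewrite row_mx0.
  have sum0 : \sum_(k < \dim U) rsubmx v 0 k *: (vbasis U)`_k = 0.
    rewrite -[RHS]wB mulmx_sum_row.
    by apply: eq_bigr => k _; rewrite rowB.
  have /freeP/(_ _ sum0) v0 := basis_free (vbasisP U).
  by apply/rowP=> k; rewrite v0 mxE.
suff eSC : (config_span h S :=: C)%MS.
  by rewrite /config_rk eSC (eqP freeC) add1n.
apply/eqmxP/andP; split.
  apply/config_span_sub=> j jS.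
  have /coord_vbasis e := direction_mem i jS.
  suff -> : h j = row_mx 1%:M (\row_k coord (vbasis U) k (p j - p i)) *m C.
    exact: submxMl.
  rewrite mulC mul1mx mulmx_sum_row; congr row_mx.
  rewrite -[LHS](subrKC (p i)) {1}e; congr (_ + _).
  by apply: eq_bigr => k _; rewrite rowB mxE.
have lift0 u : u \in U -> (row_mx 0 u <= config_span h S)%MS.
  case/directionsP=> a ->.
  have -> : row_mx 0 (\sum_(j in S) a j *: (p j - p i)) =
      \sum_(j in S) a j *: (h j - h i) :> 'rV[R]_(1 + n).
    rewrite (big_morph (fun u : 'rV[R]_n => row_mx 0 u : 'rV[R]_(1 + n))
               (id1 := 0) (op1 := +%R)).
    - apply: eq_bigr => j _; rewrite /lift_point opp_row_mx add_row_mx subrr.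
      by rewrite scale_row_mx scaler0.
    - by move=> v w; rewrite add_row_mx addr0.
    - by rewrite row_mx0.
  apply: summx_sub => j jS; rewrite scalemx_sub // addmx_sub //.
    exact: sub_config_span.
  by rewrite eqmx_opp sub_config_span.
rewrite /C block_mxEv col_mx_sub sub_config_span //=.
apply/row_subP=> k; rewrite row_row_mx row0 rowB lift0 //.
by rewrite -[in X in X \in _]/(tval _) vbasis_mem // mem_nth // size_tuple.
Qed.

Lemma hull_dim S k : has_dim (hull S) k <-> rk S = k.+1.
Proof.
(* For the empty set both sides fail: its affine hull is empty, hence no translate of a subspace,
   and its rank is 0. *)
have [->|/set0Pn[i iS]] := eqVneq S set0.
  split; last by rewrite /config_rk /config_span big_set0 mxrank0.
  move=> [q [U [e _]]]; have : [set q + u | u in [set` U]]%classic q.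
    by exists 0; rewrite ?addr0 //= mem0v.
  rewrite -e => /(@affine_hull_min _ _ _ (fun=> False)) [] //.
  by apply: convex_hull_min => [|x [j]]; rewrite ?inE //; apply/convex_setP.
rewrite (config_rk_directions iS); split.
  by move=> [q [U []]]; rewrite (affine_hull_hull iS) => /translate_eq -> ->.
by case=> <-; exists (p i), (directions S i); split=> //; apply: affine_hull_hull.
Qed.

Lemma kface_hull k F : kface k (hull setT) F <->
  exists S, [/\ S \in L, rk S = k.+1 & F = hull S].
Proof.
split=> [[/face_hull[S SL ->] /hull_dim rS]|[S [SL rS ->]]]; first by exists S.
by split; [apply: (hull_face SL).1 | apply/hull_dim].
Qed.

Lemma f_num_hull k : f_num k (hull setT) = #|[set S in L | rk S == k.+1]|.
Proof.
pose D := [set S in L | rk S == k.+1].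
rewrite /f_num; have -> : [set F | kface k (hull setT) F]%classic =
    [set` [fset hull S | S in D]%fset]%classic.
  apply/seteqP; split=> F /=.
    move=> /kface_hull[S [SL rS ->]]; apply/imfsetP; exists S => //=.
    by rewrite inE SL rS eqxx.
  case/imfsetP=> S /=; rewrite inE => /andP[SL /eqP rS] ->.
  by apply/kface_hull; exists S.
rewrite set_fsetK card_in_imfset /=; first by rewrite -cardE.
move=> S G /= SD GD.
have /setIdP[SL _] : S \in D := SD; have /setIdP[GL _] : G \in D := GD.
exact: hull_inj.
Qed.

Lemma vertex_hull x : vertex (hull setT) x <-> exists2 i, [set i] \in L & x = p i.
Proof.
have hull1 i : hull [set i] = [set p i]%classic.
  apply/seteqP; split=> [y|_ ->]; last by apply: mem_hull; rewrite inE.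
  apply: convex_hull_min => [|_ [j + ->]]; last by rewrite inE => /eqP->.
  by apply/convex_setP => _ _ t _ _ -> ->; rewrite /= -scalerDl subrKC scale1r.
split=> [/kface_hull[S [SL rS xS]]|[i iL ->]].
  have [i eS] := config_atom lift_neq0 lift_inj rS.
  exists i; rewrite -?eS //; have : hull S (p i) by apply: mem_hull; rewrite eS inE.
  by rewrite -xS.
apply/kface_hull; exists [set i]; rewrite hull1; split=> //.
exact: rk_atom lift_graded _ iL.
Qed.

(** The functional defining the vertex [p k] is strictly below its maximum at every other point,
    hence on any segment whose ends differ from [p k]. So an edge contains no third vertex. *)
Lemma vertex_in_segment i j k : [set k] \in L ->
  convex_hull [set p i; p j]%classic (p k) -> k \in [set i; j].
Proof.
move=> kL kij; apply/negPn/negP; rewrite !inE negb_or => /andP[ki kj].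
have [[c [b [cb e]]] only] := hull_face kL.
have out l : l != k -> dotv c (p l) < b.
  move=> lk; rewrite lt_neqAle cb ?andbT; last exact: mem_hull.
  apply: contra lk => /eqP lb; rewrite -in_set1; apply: only.
  by rewrite e; split=> //; apply: mem_hull.
have : hull [set k] (p k) by apply: mem_hull; rewrite inE.
rewrite e => -[_ /= kb].
suff : dotv c (p k) < b by rewrite kb ltxx.
move: kij; apply: (@convex_hull_min _ _ _ [set x | dotv c x < b]%classic).
  apply/convex_setP => x y t t0 t1 /= xb yb; rewrite dotvDr !dotvZr.
  have [->|tn0] := eqVneq t 0; first by rewrite mul0r add0r subr0 mul1r.
  have -> : b = t * b + (1 - t) * b by rewrite -mulrDl subrKC mul1r.
  apply: ltr_leD; first by rewrite ltr_pM2l // lt_def tn0.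
  by rewrite ler_wpM2l ?subr_ge0 // ltW.
by move=> _ [] ->; apply: out; rewrite eq_sym.
Qed.

End PointConfiguration.

(** * The bound for polytopes *)

Theorem neighborly_polytope_facets (R : realType) (n d : nat) (P : set 'rV[R]_n) :
    (4 <= d)%N -> d_polytope d P -> two_neighborly P -> (d + 4 <= f_num 0 P)%N ->
  (d + 7 <= f_num d.-1 P)%N.
Proof.
move=> d4 [[A /finite_fsetP[X ->] PE] dimP] nbP.
pose p (i : X) := val i; have p_inj : injective p := val_inj.
have {}PE : P = hull p setT.
  rewrite PE; congr convex_hull; apply/seteqP; split=> [x /= xX|_ [i _ ->]] /=.
    by exists (FSetSub xX).
  exact: valP.
subst P; set L := config_faces (lift_point p); set rk := config_rk (lift_point p).
have rT : rk setT = d.+1 by apply/hull_dim.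
have grL : graded_lattice L rk := lift_graded p.
have atomL S : S \in L -> rk S = 1 -> exists i, S = [set i].
  by move=> _; apply: config_atom; [apply: lift_neq0 | apply: lift_inj].
rewrite !f_num_hull // prednK; last by apply: leq_trans d4.
have -> : #|[set S in L | rk S == 1]| = #|[set i | [set i] \in L]|.
  rewrite -[RHS](card_imset _ (@set1_inj _)); apply: eq_card => S.
  apply/setIdP/imsetP => [[SL /eqP rS]|[i + ->]].
    have [i eS] := atomL S SL rS; exists i => //.
    by rewrite inE -eS.
  by rewrite inE => iL; rewrite (rk_atom grL).
have -> : #|[set S in L | rk S == d]| = #|facets L rk setT|.
  apply: eq_card => S; apply/setIdP/facetP => [[SL /eqP rS]|[SL _]].
    split; rewrite ?rS ?rT // properEneq subsetT andbT.
    by apply: contra_eqN rS => /eqP->; rewrite rT eqn_leq ltnn.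
  by rewrite rT => -[->].
(* Rank is dimension plus one: [d + 7] is [rk setT + 6], and [d + 4] vertices are one more than the
   required [rk setT + 2]. *)
move=> v4; have -> : (d + 7 = rk setT + 6)%N by rewrite rT addSnnS.
apply: (graded_many_facets grL atomL).
- move=> i j iL jL ij.
  have vi : vertex (hull p setT) (p i) by apply/vertex_hull => //; exists i.
  have vj : vertex (hull p setT) (p j) by apply/vertex_hull => //; exists j.
  have pij : p i <> p j by move=> /p_inj/eqP; rewrite (negPf ij).
  have /kface_hull[S [SL rS eS]] := nbP _ _ vi vj pij.
  exists S; split=> // k kL; apply/idP/idP.
    move=> kS; apply: (@vertex_in_segment R n _ p) => //; rewrite eS.
    exact: mem_hull.
  by rewrite !inE => /orP[]/eqP ->; apply: (hull_face SL).2; rewrite -eS;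
     apply: sub_convex_hull; [left|right].
- exact: config_setT.
by apply: leq_trans v4; rewrite rT addSnnS leq_add2l.
Qed.

Theorem theorem8 (R : realType) (d : nat) (hd : (4 <= d)%N) :
  (forall (n : nat) (P : set 'rV[R]_n),
     d_polytope d P -> two_neighborly P -> (d + 4 <= f_num 0 P)%N ->
     (d + 7 <= f_num d.-1 P)%N)
  /\ (forall v m : nat, (d + 4 <= v)%N -> is_mn R d v m -> (d + 7 <= m)%N).
Proof.
have many := fun n P => @neighborly_polytope_facets R n d P hd.
split=> // v m v4 [[n [P [dP nbP vP <-]]] _].
by apply: many => //; rewrite vP.
Qed.
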